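(* Let $X$ be a piecewise deterministic Markov process on a real interval $\mathbb E=[w,\gamma)$ with strictly increasing deterministic paths, satisfying the assumptions of the context. Then its stationary distribution $\nu$ is absolutely continuous (with respect to Lebesgue measure) on $[w,\gamma)$, and the density $\nu'$ of $\nu$ fulfils the integro-differential equation $$r(x)\nu'(x)=\int_w^\gamma\lambda(z)\,\theta(x,z)\,\nu'(z)\,dz+\sigma(\{\gamma\})\,\theta(x,\gamma),\qquad x\in(w,\gamma),$$ where $$\theta(x,z)=1_{\{x\le z\}}\mu_z([w,x))-1_{\{x>z\}}\mu_z([x,\gamma))=\mu_z([w,x))-1_{\{x>z\}}.$$ (If $\gamma=\infty$ the active boundary is empty and the last term is absent.)
   Context: **Setting.** $-\infty\le w<\gamma\le\infty$ and $\mathbb E=[w,\gamma)$ (if $w=-\infty$, $[w,\cdot)$ is read as $(-\infty,\cdot)$), $\mathbb E^\circ=(w,\gamma)$. $r:\mathbb E\to\mathbb R$ is locally Lipschitz with $r(x)>0$ for $x\in\mathbb E^\circ$; the flow $\varphi(x,t)$ solves $\partial_t\varphi(x,t)=r(\varphi(x,t))$, $\varphi(x,0)=x$, without explosion, and $t\mapsto\varphi(x,t)$ is strictly increasing. If $\gamma<\infty$, then $\gamma$ is reached by the flow in finite time and the active boundary is $\Gamma=\{\gamma\}$; if $\gamma=\infty$, $\Gamma=\emptyset$. Let $\tau(x)=\inf\{t\ge0:\varphi(x,t)\in\Gamma\}$ ($\inf\emptyset=\infty$). Given a measurable jump intensity $\lambda:\mathbb E\to[0,\infty)$ and probability measures $\mu_x$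 on $\mathbb E$, $x\in\mathbb E\cup\Gamma$, the process $X$ started at $x$ follows $X_t=\varphi(x,t)$ for $t<T_1$, where $P_x(T_1>t)=1_{\{t<\tau(x)\}}\exp(-\int_0^t\lambda(\varphi(x,u))du)$; at $T_1$ it jumps to a point with distribution $\mu_{\varphi(x,T_1)}$ and restarts from there. $N_t$ is the number of jumps in $[0,t]$ and $N_t^+$ the number of forced jumps (jumps from $\gamma$) in $[0,t]$. **Standing assumptions.** (A1) For each $x\in\mathbb E$ there is $\varepsilon(x)>0$ with $\int_0^{\varepsilon(x)}\lambda(\varphi(x,s))ds<\infty$. (A2) $\int_0^\infty\lambda(\varphi(x,s))ds=\infty$ whenever $\tau(x)=\infty$. (A3) $E_x(N_t)<\infty$ for all $x\in\mathbb E,t>0$. (A4) $\mu_x(\{x\})=0$ for all $x\in\mathbb E$. (B1) There is a stationary distribution $\nu$ of $X$ on $\mathbb E$. (B2) $\int_{\mathbb E}\lambda\,d\nu<\infty$. (B3) $\lambda$ is continuous. (B4) For Borel $A\subseteq\mathbb E$ and $x\in\mathbb E$, $\mu_{\varphi(x,h)}(A)\to\mu_x(A)$ as $h\to0$. (B5) If $\gamma<\infty$, $\mu_\gamma(\{x\in\mathbb E:\tau(x)<h\})\to0$ as $h\to0$. **Boundary measure.** $\sigma(\{\gamma\})=E_\nu(N_t^+)/t$ for every $t>0$ (the stationary rate of hits of $\gamma$; finite). $E_\nu$ denotes expectation when $X_0\sim\nu$. *)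

(* Defs.v *)
From HB Require Import structures.
From mathcomp Require Import all_boot all_order all_algebra.
From mathcomp Require Import all_classical all_reals all_analysis.

Set Implicit Arguments.
Unset Strict Implicit.
Unset Printing Implicit Defensive.

Import Order.TTheory GRing.Theory Num.Theory.
Import numFieldNormedType.Exports.

Local Open Scope classical_set_scope.
Local Open Scope ring_scope.
Local Open Scope ereal_scope.

Section state_space.
Context {R : realType} (w gamma : \bar R).

(* [w, gamma), which is (-oo, gamma) when w = -oo *)
Definition state_space : set R := [set x | w <= x%:E < gamma].

Definition state_interior : set R := [set x | w < x%:E < gamma].

(* {gamma} if gamma is finite, empty if gamma = +oo *)
Definition active_boundary : set R := [set x | x%:E = gamma].

(* ereal_inf set0 = +oo *)
Definition hitting_time (phi : R -> R -> R) (x : R) : \bar R :=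
  ereal_inf [set t%:E | t in [set t : R |
    (0 <= t)%R /\ active_boundary (phi x t)]].

(* The values phi x t are only meaningful for x in the state space and t
   between 0 and the hitting time of gamma; nothing is required elsewhere. *)
Record is_flow (r : R -> R) (phi : R -> R -> R) : Prop := IsFlow {
  flow_velocity_lipschitz : [locally [lipschitz r x | x in state_space]] ;
  flow_velocity_gt0 : forall x, state_interior x -> (0 < r x)%R ;
  flow0 : forall x, state_space x -> phi x 0%R = x ;
  flow_in : forall x t, state_space x ->
    (0 <= t)%R -> t%:E < hitting_time phi x -> state_space (phi x t) ;
  (* a two-sided derivative for t > 0, a right derivative for t = 0 *)
  flow_derive : forall x t, state_space x ->
    (0 <= t)%R -> t%:E < hitting_time phi x ->
    ((phi x s - phi x t) / (s - t))%R
      @[s --> within [set s : R | (0 <= s)%R] t^'] --> r (phi x t) ;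
  flow_continuous : forall x, state_space x ->
    {within [set t : R | (0 <= t)%R /\ t%:E <= hitting_time phi x],
      continuous (phi x)} ;
  flow_increasing : forall x s t, state_space x ->
    (0 <= s)%R -> (s < t)%R -> t%:E <= hitting_time phi x ->
    (phi x s < phi x t)%R ;
  flow_hits : forall x, state_space x -> gamma < +oo ->
    hitting_time phi x < +oo /\
    active_boundary (phi x (fine (hitting_time phi x)))
}.

(* P_x(T_1 > t) for t >= 0; expeR -oo = 0 covers an infinite integral. *)
Definition survival (phi : R -> R -> R) (lambda : R -> R) (x t : R) : \bar R :=
  if t%:E < hitting_time phi x then
    expeR (- \int[lebesgue_measure]_(u in `[0%R, t]) (lambda (phi x u))%:E)
  else 0.

End state_space.

Section process.
Context {R : realType} (w gamma : \bar R) (phi : R -> R -> R).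
Context d (Omega : measurableType d).
(* Z n is the position after the n-th jump (Z 0 the initial position) and S n
   the time elapsed between the n-th and the (n+1)-st jump. *)
Variables Z S : nat -> Omega -> R.

Definition jump_time (n : nat) (o : Omega) : R := (\sum_(i < n) S i o)%R.

(* sigma-algebra generated by Z 0, ..., Z (n-1), S 0, ..., S (m-1) *)
Definition history (n m : nat) : set (set Omega) :=
  <<s [set B | exists i (A : set R), measurable A /\
         ((i < n)%N /\ B = Z i @^-1` A \/ (i < m)%N /\ B = S i @^-1` A)] >>.

(* X_t = phi(Z_n, t - T_n) for T_n <= t < T_(n+1); the default Z 0 is only used
   when infinitely many jumps occur before time t. *)
Definition pdmp_path (t : R) (o : Omega) : R :=
  xget (Z 0%N o) [set phi (Z n o) (t - jump_time n o)%R |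
    n in [set n : nat | (jump_time n o <= t < jump_time n.+1 o)%R]].

(* N_t *)
Definition jumps (t : R) (o : Omega) : \bar R :=
  \sum_(0 <= n <oo) (\1_[set o | (jump_time n.+1 o <= t)%R] o)%:E.

(* N_t^+, counting the jumps that occur when the flow is in gamma *)
Definition forced_jumps (t : R) (o : Omega) : \bar R :=
  \sum_(0 <= n <oo) (\1_[set o | (jump_time n.+1 o <= t)%R /\
    active_boundary gamma (phi (Z n o) (S n o))] o)%:E.

Variables (lambda : R -> R)
  (mu : R.-pker (measurableTypeR R) ~> (measurableTypeR R))
  (P : R.-pker (measurableTypeR R) ~> Omega).

(* P x is the law of the process started at x. The last two fields give the
   conditional laws of S n and Z (n+1) given the past; being conditional laws
   with respect to a sigma-algebra, they are stated in integrated form. *)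
Record is_pdmp : Prop := IsPDMP {
  pdmp_measurable_position : forall n, measurable_fun setT (Z n) ;
  pdmp_measurable_sojourn : forall n, measurable_fun setT (S n) ;
  pdmp_position_in : forall n o, state_space w gamma (Z n o) ;
  pdmp_sojourn_gt0 : forall n o, (0 < S n o)%R ;
  pdmp_sojourn_le : forall n o, (S n o)%:E <= hitting_time gamma phi (Z n o) ;
  pdmp_start : forall x, state_space w gamma x -> P x (Z 0%N @^-1` [set x]) = 1 ;
  pdmp_sojourn_law : forall x n H t, state_space w gamma x ->
    history n.+1 n H -> (0 <= t)%R ->
    P x (H `&` [set o | (t < S n o)%R]) =
      \int[P x]_(o in H) survival gamma phi lambda (Z n o) t ;
  pdmp_jump_law : forall x n H (A : set R), state_space w gamma x ->
    history n.+1 n.+1 H -> measurable A ->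
    P x (H `&` Z n.+1 @^-1` A) =
      \int[P x]_(o in H) mu (phi (Z n o) (S n o)) A
}.

Record is_stationary (nu : probability (measurableTypeR R) R) : Prop :=
  IsStationary {
  stationary_on : nu (state_space w gamma) = 1 ;
  stationary_eq : forall t (A : set R), (0 <= t)%R -> measurable A ->
    \int[nu]_(x in state_space w gamma) P x (pdmp_path t @^-1` A) = nu A
}.

(* sigma({gamma}) = E_nu(N_t^+) / t for every t > 0 *)
Definition is_boundary_rate (nu : probability (measurableTypeR R) R)
    (sigma : R) : Prop :=
  forall t : R, (0 < t)%R ->
    sigma%:E = (\int[nu]_(x in state_space w gamma)
                  \int[P x]_o forced_jumps t o) * (t^-1)%:E.

End process.

Section equation.
Context {R : realType} (w gamma : \bar R).

Definition theta (mu : R.-pker (measurableTypeR R) ~> (measurableTypeR R))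
    (x z : R) : R :=
  ((x <= z)%R%:R * fine (mu z [set y : R | (w <= y%:E < x%:E)%E])
   - (z < x)%R%:R * fine (mu z [set y : R | (x%:E <= y%:E < gamma)%E]))%R.

Record is_density (nu : probability (measurableTypeR R) R) (f : R -> R) :
    Prop := IsDensity {
  density_measurable : measurable_fun (state_space w gamma) f ;
  density_ge0 : forall x, state_space w gamma x -> (0 <= f x)%R ;
  density_eq : forall A : set R, measurable A -> A `<=` state_space w gamma ->
    nu A = \int[lebesgue_measure]_(x in A) (f x)%:E
}.

End equation.

(* Main.v *)
Require Import Defs.
From HB Require Import structures.
From mathcomp Require Import all_boot all_order all_algebra.
From mathcomp Require Import all_classical all_reals all_analysis.
From mathcomp Require Import measurable_realfun giry.
From mathcomp Require Import ring lra.

Set Implicit Arguments.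
Unset Strict Implicit.
Unset Printing Implicit Defensive.

Import Order.TTheory GRing.Theory Num.Theory.
Import numFieldNormedType.Exports.

Local Open Scope classical_set_scope.
Local Open Scope ring_scope.
Local Open Scope ereal_scope.

(** At every level x the stationary process crosses upwards as often as
downwards. The deterministic motion, which is increasing, crosses x at rate
r(x) nu'(x), the jumps are responsible for the other crossings, and the
equation is the balance of the two. Since the existence of the density nu' is
part of the claim, the balance is first established for levels averaged over
an interval [a, b) with the weight 1 / r ([slowness]).

With this weight, f(y) = \int_a^b 1{x <= y} dx / r(x) ([rise]) increases along
the flow by the time spent in [a, b) ([rise_occupation]), because 1 / r is the
time that the flow takes per unit of space ([clock_flow]). Following f along
the path up to time 1, the expected sum of its values just before the jumps
exceeds that of its values just after them by the expected time spent in
[a, b), the values at times 0 and 1 having the same expectation by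
stationarity ([jump_balance]); and this expected time is nu[a, b)
([integral_occupation]). Let U(x) and D(x) be the expected numbers of jumps up
to time 1 that start, respectively end, at or above x ([takeoff_rate],
[arrival_rate]). Tonelli's theorem turns the identity into
  \int_a^b U(x) dx / r(x) = \int_a^b D(x) dx / r(x) + nu[a, b)
([slowness_balance]). The same argument for the function 1{x <= y} of y, which
is nondecreasing along the flow, gives D <= U ([arrival_le_takeoff]). Hence
(U - D) / r is a density of nu on (w, gamma), and nu does not charge w, which
the flow leaves at once ([stationary_density]).

It remains to compute U and D. Up to time 1, the states from which the jumps
occur are distributed as pi = lambda nu + sigma delta_gamma
([sum_integral_landing]): the jumps from gamma are counted by sigma, and the
other ones occur at rate lambda along the path, because before the boundary is
reached the time to the next jump has the density lambda times the
probability that it is not over ([integral_unforced_jump]). The law of the jumps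
then yields
  U(x) - D(x) = \int (1{x <= z} - mu_z[x, gamma)) pi(dz),
whose integrand is theta(x, z) ([theta_above]), and this is the equation
([density_equation]).

Everything takes place under one law, the average of the laws P_x with respect
to nu ([averaged_law]), for which explosion has probability 0 because the
expected number of jumps is finite ([explosion_event_null]). *)

(** * Weighted images of measures *)

Section weighted_image.
Context d d' (T : measurableType d) (V : measurableType d') (R : realType).
Variables (m : {measure set T -> \bar R}) (h : T -> \bar R) (f : T -> V).

(** The image by [f] of the measure of density [h] with respect to [m]. The
proofs are arguments so that the measure structure can be inferred from the
term. *)
Definition weighted_image (_ : measurable_fun [set: T] h)
    (_ : forall x, 0 <= h x) (_ : measurable_fun [set: T] f) (A : set V) :=
  \int[m]_(x in f @^-1` A) h x.

Hypotheses (mh : measurable_fun [set: T] h) (h0 : forall x, 0 <= h x)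
  (mf : measurable_fun [set: T] f).

Let image := weighted_image mh h0 mf.

Let image_set0 : image set0 = 0.
Proof. by rewrite /image /weighted_image preimage_set0 integral_set0. Qed.

Let image_ge0 A : 0 <= image A.
Proof. by apply: integral_ge0 => x _; exact: h0. Qed.

Let image_sigma_additive : semi_sigma_additive image.
Proof.
move=> F mF tF mUF; rewrite /image /weighted_image preimage_bigcup.
rewrite ge0_integral_bigcup//.
- apply: is_cvg_nneseries => n _ _.
  by apply: integral_ge0 => x _; exact: h0.
- by move=> n; rewrite -[X in measurable X]setTI; exact: mf.
- exact: measurable_funTS.
- apply/trivIsetP => /= i j _ _ ij; rewrite -preimage_setI.
  by move/trivIsetP : tF => /(_ _ _ _ _ ij) ->//; rewrite preimage_set0.
Qed.

HB.instance Definition _ := isMeasure.Build _ _ _ (weighted_image mh h0 mf)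
  image_set0 image_ge0 image_sigma_additive.

Import HBNNSimple.

(** The formula is additive and passes to increasing limits, and simple
functions reduce it to the definition. *)
Lemma ge0_integral_weighted_image (g : V -> \bar R) :
  (forall x, h x \is a fin_num) ->
  measurable_fun [set: V] g -> (forall y, 0 <= g y) ->
  \int[weighted_image mh h0 mf]_y g y = \int[m]_x (g (f x) * h x).
Proof.
move=> hfin mg g0; pose g_ := nnsfun_approx measurableT mg.
have mgf n : measurable_fun [set: T] (fun x => (g_ n (f x))%:E : \bar R).
  by apply/measurable_EFinP; exact: measurableT_comp.
transitivity (limn (fun n => \int[weighted_image mh h0 mf]_y (g_ n y)%:E)).
  rewrite -monotone_convergence//.
  - apply: eq_integral => y _; apply/esym/cvg_lim => //.
    exact: cvg_nnsfun_approx.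
  - by move=> n; exact/measurable_EFinP/measurable_funP.
  - by move=> n y _; rewrite lee_fin.
  - by move=> y _ a b ab; rewrite lee_fin; exact/lefP/nd_nnsfun_approx.
transitivity (limn (fun n => \int[m]_x ((g_ n (f x))%:E * h x))); last first.
  rewrite -monotone_convergence//.
  - apply: eq_integral => x _; apply/cvg_lim => //.
    by apply: cvgeZr => //; exact: cvg_nnsfun_approx.
  - by move=> n; exact: emeasurable_funM.
  - by move=> n x _; rewrite mule_ge0// lee_fin.
  - move=> x _ a b ab; rewrite lee_wpmul2r// lee_fin.
    exact/lefP/nd_nnsfun_approx.
congr (limn _); apply/funext => n.
rewrite integralT_nnsfun sintegralE.
under [RHS]eq_integral.
  move=> x _; rewrite fimfunE -fsumEFin// ge0_mule_fsuml; last first.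
    by move=> r; rewrite nnfun_muleindic_ge0.
  over.
have mindic r : measurable_fun [set: T] (fun x => (\1_(g_ n @^-1` [set r]) (f x))%:E : \bar R).
  by apply/measurable_EFinP; exact: measurableT_comp.
rewrite ge0_integral_fsum//; last 2 first.
- move=> r; apply: emeasurable_funM => //.
  under eq_fun do rewrite EFinM.
  by apply: emeasurable_funM.
- by move=> r x _; rewrite mule_ge0// nnfun_muleindic_ge0.
apply: eq_fsbigr => r /set_mem -[x _ <-].
under eq_integral do rewrite EFinM -muleA.
rewrite ge0_integralZl//; last 3 first.
- exact: emeasurable_funM.
- by move=> y _; rewrite mule_ge0// lee_fin.
- by rewrite lee_fin.
congr (_ * _); rewrite /weighted_image [LHS]integral_mkcond.
apply: eq_integral => y _; rewrite patchE indicE.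
have -> A : (y \in f @^-1` A) = (f y \in A) by apply/idP/idP; rewrite !inE.
by case: ifPn => _; rewrite ?mul1e ?mul0e.
Qed.

End weighted_image.

(** * Sums, indicators and measures on the line *)

Lemma adde_injl (R : realDomainType) (x y z : \bar R) :
  x \is a fin_num -> x + y = x + z -> y = z.
Proof.
by case: x y z => [x| |]// [y| |]// [z| |]//= _ [] /addrI ->.
Qed.

Lemma nneseries_cst_eq0 (R : realType) (c : \bar R) :
  0 <= c -> \sum_(n <oo) c < +oo -> c = 0.
Proof.
move=> c0 fin; apply: (@adde_injl _ (\sum_(n <oo) c)).
  by rewrite ge0_fin_numE//; exact: nneseries_ge0.
rewrite adde0 [in RHS](@nneseries_recl _ predT (fun=> c))// addeC; congr (_ + _).
exact: (@nneseries_addn _ (fun=> c) 1).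
Qed.

Lemma mem_setb (T : Type) (P : pred T) (x : T) : (x \in [set y | P y]) = P x.
Proof. by apply/idP/idP; rewrite inE. Qed.

Lemma measurable_set_lt d (T : measurableType d) (R : realType) (f g : T -> R) :
  measurable_fun [set: T] f -> measurable_fun [set: T] g ->
  measurable [set x | (f x < g x)%R].
Proof.
move=> mf mg; rewrite (_ : [set _ | _] = setT `&` [set x | (f x)%:E < (g x)%:E]).
  by apply: measurable_lte => //; apply/measurable_EFinP.
by rewrite setTI; apply/seteqP; split => x /=; rewrite lte_fin.
Qed.

Lemma measurable_set_le d (T : measurableType d) (R : realType) (f g : T -> R) :
  measurable_fun [set: T] f -> measurable_fun [set: T] g ->
  measurable [set x | (f x <= g x)%R].
Proof.
move=> mf mg; rewrite (_ : [set _ | _] = setT `&` [set x | (f x)%:E <= (g x)%:E]).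
  by apply: measurable_lee => //; apply/measurable_EFinP.
by rewrite setTI; apply/seteqP; split => x /=; rewrite lee_fin.
Qed.

Lemma measurable_fun_bool_indic d (T : measurableType d) (R : realType)
    (b : T -> bool) : measurable [set x | b x] ->
  measurable_fun [set: T] (fun x => (b x)%:R%:E : \bar R).
Proof.
move=> mb; rewrite (_ : (fun _ => _) = fun x => (\1_[set x | b x] x)%:E).
  by apply/measurable_EFinP; exact: measurable_indic.
by apply/funext => x; rewrite indicE mem_setb.
Qed.

Lemma integral_bool_indic d (T : measurableType d) (R : realType)
    (m : {measure set T -> \bar R}) (D : set T) (b : T -> bool) :
  measurable D -> measurable [set x | b x] ->
  \int[m]_(x in D) (b x)%:R%:E = m (D `&` [set x | b x]).
Proof.
move=> mD mb; rewrite setIC -integral_indic//.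
by apply: eq_integral => x _; rewrite indicE mem_setb.
Qed.

(** The rays are open for [b = true] and closed for [b = false]; in both cases
they are stable by intersection and generate the Borel sets. *)
Lemma finite_measure_unique_ray (R : realType) (b : bool)
    (m1 m2 : {measure set (measurableTypeR R) -> \bar R}) :
  m1 setT < +oo ->
  (forall v : R, m1 [set` Interval -oo%O (BSide b v)] =
                 m2 [set` Interval -oo%O (BSide b v)]) ->
  forall B, measurable B -> m1 B = m2 B.
Proof.
move=> m1oo m12; pose G : set (set (measurableTypeR R)) :=
  [set B | exists v : R, B = [set` Interval -oo%O (BSide b v)]].
have GI : setI_closed G.
  move=> _ _ [u ->] [v ->]; exists (Order.min u v).
  by apply/seteqP; split => x /=; case: (b); rewrite !in_itv/= ?le_min ?lt_min => /andP.
apply: (measure_unique G (fun n : nat => [set` Interval -oo%O (BSide b n%:R)])) => //.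
- apply/seteqP; split.
    case: (b) @G GI => G GI.
      rewrite RGenInftyO.measurableE; apply: smallest_sub.
        exact: smallest_sigma_algebra.
      by move=> _ [v ->]; apply: sub_sigma_algebra; exists v.
    rewrite RGenOInfty.measurableE; apply: smallest_sub.
      exact: smallest_sigma_algebra.
    move=> _ [v ->]; rewrite -setCitvl.
    by apply: sigma_algebraC; apply: sub_sigma_algebra; exists v.
  apply: smallest_sub; first exact: sigma_algebra_measurable.
  by move=> _ [v ->]; exact: measurable_itv.
- by move=> n; exists n%:R.
- apply/seteqP; split => // x _; exists (Num.bound `|x : R|) => //=.
  have xb : (x < (Num.bound `|x : R|)%:R :> R)%R.
    by rewrite (le_lt_trans (ler_norm (x : R)))// archi_boundP.
  by rewrite in_itv/=; case: (b); rewrite /= ?(ltW xb).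
- by move=> _ [v ->]; exact: m12.
- by move=> n; apply: le_lt_trans m1oo; apply: le_measure; rewrite ?inE.
Qed.

Lemma finite_measure_unique_raysX d (X : measurableType d) (R : realType)
    (m1 m2 : {measure set (X * measurableTypeR R) -> \bar R}) :
  m1 setT < +oo ->
  (forall (A : set X) (v : R), measurable A ->
     m1 (A `*` `]-oo, v]%classic) = m2 (A `*` `]-oo, v]%classic)) ->
  forall C, measurable C -> m1 C = m2 C.
Proof.
move=> m1oo m12.
pose G := [set A `*` B | A in @measurable _ X & B in @measurable _ (measurableTypeR R)].
have m1fin C : measurable C -> m1 C < +oo.
  by move=> mC; apply: le_lt_trans m1oo; apply: le_measure; rewrite ?inE.
apply: (measure_unique G (fun _ => setT)) => //.
- exact: measurable_prod_measurableType.
- move=> _ _ [A1 mA1 [B1 mB1 <-]] [A2 mA2 [B2 mB2 <-]].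
  exists (A1 `&` A2); first exact: measurableI.
  by exists (B1 `&` B2); [exact: measurableI|rewrite setXI].
- by move=> _; exists setT => //; exists setT => //; rewrite setXTT.
- by apply/seteqP; split => // x _; exists 0%N.
move=> _ [A mA [B mB <-]].
have mAT : measurable (A `*` [set: measurableTypeR R]) by exact: measurableX.
pose n1 := pushforward (mrestr m1 mAT) (@snd X (measurableTypeR R)).
pose n2 := pushforward (mrestr m2 mAT) (@snd X (measurableTypeR R)).
have nE (m : {measure set (X * measurableTypeR R) -> \bar R}) B' :
    m (A `*` B') = pushforward (mrestr m mAT) (@snd X (measurableTypeR R)) B'.
  rewrite /pushforward /mrestr; congr (m _); apply/seteqP; split => -[x y] /=.
    by move=> [].
  by move=> [? []].
rewrite !nE.
apply: (@finite_measure_unique_ray R false n1 n2) => //.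
- by rewrite -[X in X < _](nE m1 setT) m1fin.
- by move=> v; rewrite -[LHS](nE m1) -[RHS](nE m2); exact: m12.
Qed.

Lemma ge0_integral_shift (R : realType) (c : R) (f : R -> \bar R) :
  measurable_fun [set: R] f -> (forall x, 0 <= f x) ->
  \int[lebesgue_measure]_x f (c + x)%R = \int[lebesgue_measure]_x f x.
Proof.
move=> mf f0.
have mc : measurable_fun [set: measurableTypeR R] (fun x : measurableTypeR R => (c + x)%R : measurableTypeR R).
  exact: measurable_funD.
rewrite -[LHS](@ge0_integral_pushforward _ _ _ _ _ _ mc lebesgue_measure setT)//.
apply: eq_measure_integral => //= A mA _; apply/esym/lebesgue_measure_unique => //.
move=> _ [[a b] _ <-] /=; transitivity (lebesgue_measure `](a - c)%R, (b - c)%R]%classic).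
  rewrite !lebesgue_measure_itv/= !lte_fin ltrD2r; case: ifP => // _.
  by rewrite -!EFinD; congr _%:E; lra.
rewrite /pushforward; congr (lebesgue_measure _); apply/seteqP.
by split => x /=; rewrite !in_itv/= ltrBlDl lerBrDl.
Qed.

Section interior.
Context {R : realType} (w gamma : \bar R).
Local Notation I := (state_interior w gamma).
Local Notation T := (measurableTypeR R).

(** [lo n, hi n) increases to (w, gamma). *)
Let lo (n : nat) : R := if w is v%:E then (v + n.+1%:R^-1)%R else (- n%:R)%R.
Let hi (n : nat) : R := if gamma is v%:E then (v - n.+1%:R^-1)%R else n%:R.

Let inv_le m n : (m <= n)%N -> (n.+1%:R^-1 <= m.+1%:R^-1 :> R)%R.
Proof. by move=> mn; rewrite lef_pV2 ?posrE// ler_nat ltnS. Qed.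

Let lo_le m n : (m <= n)%N -> (lo n <= lo m)%R.
Proof.
by move=> mn; rewrite /lo; case: w => [v| |]; rewrite ?lerD2l ?lerN2 ?ler_nat ?inv_le.
Qed.

Let hi_le m n : (m <= n)%N -> (hi m <= hi n)%R.
Proof.
by move=> mn; rewrite /hi; case: gamma => [v| |]; rewrite ?lerD2l ?lerN2 ?ler_nat ?inv_le.
Qed.

Let lo_gt n : w != +oo -> w < (lo n)%:E.
Proof. by rewrite /lo; case: w => [v| |]//= _; rewrite ?ltNyr// lte_fin ltrDl invr_gt0. Qed.

Let hi_lt n : gamma != -oo -> (hi n)%:E < gamma.
Proof.
by rewrite /hi; case: gamma => [v| |]//= _; rewrite ?ltry// lte_fin ltrBlDr ltrDl invr_gt0.
Qed.

Let lo_near x : w < x%:E -> \forall n \near \oo, (lo n <= x)%R.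
Proof.
rewrite /lo; case: w => [v| |]//= => [|_].
  rewrite lte_fin -subr_gt0 => vx; near=> n; rewrite -lerBrDl ltW//.
  by near: n; exact: (near_infty_natSinv_lt (PosNum vx)).
by near=> n; rewrite lerNl; near: n; exact: nbhs_infty_ger.
Unshelve. all: by end_near. Qed.

Let hi_near x : x%:E < gamma -> \forall n \near \oo, (x < hi n)%R.
Proof.
rewrite /hi; case: gamma => [v| |]//= => [|_].
  rewrite lte_fin -subr_gt0 => xv; near=> n; rewrite ltrBrDr addrC -ltrBrDr.
  by near: n; exact: (near_infty_natSinv_lt (PosNum xv)).
by near=> n; near: n; exact: nbhs_infty_gtr.
Unshelve. all: by end_near. Qed.

(** On each of the intervals [lo n, hi n), which exhaust the interior, the
traces of the rays are intervals of the hypothesis. *)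
Lemma finite_measure_unique_interior (m1 m2 : {measure set T -> \bar R}) :
  m1 setT < +oo ->
  (forall a b, I a -> I b -> (a <= b)%R -> m1 `[a, b[%classic = m2 `[a, b[%classic) ->
  forall A, measurable A -> A `<=` I -> m1 A = m2 A.
Proof.
move=> m1oo m12 A mA AI.
have [->|/set0P[c Ac]] := eqVneq A set0; first by rewrite !measure0.
have /andP[wc cg] := AI _ Ac.
have w_neq : w != +oo by rewrite -ltey (lt_trans wc)// ltry.
have g_neq : gamma != -oo by rewrite -ltNye (lt_trans _ cg)// ltNyr.
pose J n : set T := `[lo n, hi n[%classic.
have mJ n : measurable (J n) by exact: measurable_itv.
have m12J n B : measurable B -> m1 (B `&` J n) = m2 (B `&` J n).
  apply: (@finite_measure_unique_ray R true (mrestr m1 (mJ n)) (mrestr m2 (mJ n))) => [|v].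
    rewrite /= /mrestr; apply: le_lt_trans m1oo.
    by apply: le_measure; rewrite ?inE//; exact: measurableI.
  rewrite /= /mrestr.
  have -> : `]-oo, v[%classic `&` J n = `[lo n, Order.min v (hi n)[%classic.
    apply/seteqP; split => x /=; rewrite /J /= !in_itv/= lt_min.
      by move=> [-> /andP[-> ->]].
    by move=> /and3P[-> -> ->].
  have [lt_lo|ge_lo] := ltP (lo n) (Order.min v (hi n)); last first.
    by rewrite set_itv_ge ?measure0// -leNgt bnd_simp.
  apply: m12; last exact: ltW.
    apply/andP; split; first exact: lo_gt.
    rewrite (lt_trans _ (hi_lt n g_neq))// lte_fin.
    by move: lt_lo; rewrite lt_min => /andP[].
  apply/andP; split; first by rewrite (lt_trans (lo_gt n w_neq))// lte_fin.
  by rewrite (le_lt_trans _ (hi_lt n g_neq))// lee_fin ge_min lexx orbT.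
have AJ : \bigcup_n (A `&` J n) = A.
  apply/seteqP; split => [x [n _ []//]|x Ax].
  have /andP[wx xg] := AI _ Ax.
  have : \forall n \near \oo, (lo n <= x)%R /\ (x < hi n)%R.
    by near=> n; split; near: n; [exact: lo_near|exact: hi_near].
  by move=> [n _ /(_ n (leqnn n)) [lox xhi]]; exists n => //; split => //; rewrite /J /= in_itv/= lox.
have cvgA (m : {measure set T -> \bar R}) : m (A `&` J n) @[n --> \oo] --> m A.
  rewrite -{2}AJ; apply: nondecreasing_cvg_mu.
  - by move=> n; exact: measurableI.
  - by rewrite AJ.
  move=> n1 n2 n12; apply/subsetPset => x [Ax]; rewrite /J /= !in_itv/= => /andP[lox xhi].
  by split => //; rewrite (le_trans (lo_le n12))//= (lt_le_trans xhi)// hi_le.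
apply: (cvg_unique _ (cvgA m1)); first exact: ereal_hausdorff.
by rewrite (_ : (fun n => _) = fun n => m2 (A `&` J n)); [exact: cvgA|apply/funext => n; exact: m12J].
Unshelve. all: by end_near. Qed.

End interior.

(** * Averaging a probability kernel *)

Section averaged_law.
Context d d' (T : measurableType d) (Omega : measurableType d') (R : realType).
Variables (P : R.-pker T ~> Omega) (nu : probability T R).

(** The kernel as a family of subprobabilities, to be averaged by the bind
operation of the Giry monad. *)
Definition law_from (x : T) : set Omega -> \bar R := P x.

HB.instance Definition _ (x : T) := Measure.on (law_from x).

Let law_from_setT x : law_from x [set: Omega] <= 1.
Proof. by rewrite /law_from prob_kernel. Qed.

HB.instance Definition _ (x : T) :=
  Measure_isSubProbability.Build _ _ _ (law_from x) (law_from_setT x).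

Lemma measurable_law_from :
  measurable_fun [set: T] (law_from : T -> giry Omega R).
Proof.
by apply: measurable_giry_codensity => // B mB; exact: measurable_kernel.
Qed.

Definition averaged_law : subprobability Omega R :=
  giry_bind (nu : giry T R) measurable_law_from.

Lemma averaged_lawE A : measurable A -> averaged_law A = \int[nu]_x P x A.
Proof.
move=> mA; rewrite /averaged_law /giry_bind /=.
rewrite /giry_join /= giry_int_map//; exact: measurable_giry_ev.
Qed.

Lemma integral_averaged_law (h : Omega -> \bar R) :
  measurable_fun [set: Omega] h -> (forall x, 0 <= h x) ->
  \int[averaged_law]_o h o = \int[nu]_x \int[P x]_o h o.
Proof. by move=> mh h0; exact: giry_int_bind. Qed.

Lemma measurable_integral_law_from (h : Omega -> \bar R) :
  measurable_fun [set: Omega] h -> (forall x, 0 <= h x) ->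
  measurable_fun [set: T] (fun x => \int[P x]_o h o).
Proof.
move=> mh h0; exact: measurableT_comp (measurable_giry_int mh h0) measurable_law_from.
Qed.

End averaged_law.

Lemma ge0_integral_full_set d (T : measurableType d) (R : realType)
    (nu : probability T R) (E : set T) (h : T -> \bar R) :
  measurable E -> nu E = 1 ->
  measurable_fun [set: T] h -> (forall x, 0 <= h x) ->
  \int[nu]_x h x = \int[nu]_(x in E) h x.
Proof.
move=> mE nuE mh h0; have mEC := measurableC mE.
have nuEC : nu (~` E) = 0 by rewrite probability_setC// nuE subee.
rewrite -(setUv E) ge0_integral_setU//; last 2 first.
- exact: measurable_funTS.
- by apply/disj_setPS => x [].
rewrite [X in _ + X]null_set_integral ?adde0//; exact: measurable_funTS.
Qed.

(** * The clock of the flow *)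

Section flow.
Context {R : realType} (w gamma : \bar R) (r : R -> R) (phi : R -> R -> R).
Hypotheses (flow : is_flow w gamma r phi).

Local Notation E := (state_space w gamma).
Local Notation I := (state_interior w gamma).
Local Notation tau := (hitting_time gamma phi).
Local Notation leb := (@lebesgue_measure R).

Lemma interior_space x : I x -> E x.
Proof. by move=> /andP[/ltW wx xg]; apply/andP. Qed.

Lemma measurable_state_space : measurable E.
Proof.
rewrite (_ : E = [set x | w <= x%:E] `&` [set x | x%:E < gamma]).
  apply: measurableI; rewrite -[X in measurable X]setTI.
    exact: measurable_lee.
  exact: measurable_lte.
by apply/seteqP; split => x => [/andP[]|[? ?]]//; apply/andP.
Qed.

Lemma near_state_interior x : I x -> \forall y \near x, I y.
Proof.
move=> /andP[wx xg]; near=> y; apply/andP; split; near: y.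
  case: w wx => [v| |]//; rewrite ?lte_fin => vx; near=> y.
    by rewrite lte_fin; near: y; exact: lt_nbhsr.
  by rewrite ltNyr.
case: gamma xg => [g| |]//; rewrite ?lte_fin => xg; near=> y.
  by rewrite lte_fin; near: y; exact: lt_nbhsl.
by rewrite ltry.
Unshelve. all: by end_near. Qed.

Lemma open_state_interior : open I.
Proof. by rewrite openE => x /near_state_interior. Qed.

Lemma measurable_state_interior : measurable I.
Proof. apply: open_measurable; exact: open_state_interior. Qed.

Lemma velocity_continuous x : I x -> {for x, continuous r}.
Proof.
move=> Ix; have Ex := interior_space Ix.
have [M [Mreal HM]] := flow_velocity_lipschitz flow (conj Ex Ex : (E `*` E) (x, x)).
have M1 : (0 < `|M| + 1)%R by rewrite ltr_pwDr.
have ltM : (M < `|M| + 1)%R by rewrite (le_lt_trans (ler_norm M))// ltrDl.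
have [[A B] /= [xA xB] AB] := HM _ ltM.
apply/cvgrPdist_lt => e e0.
have d0 : (0 < (`|M| + 1)^-1 * e)%R by rewrite mulr_gt0// invr_gt0.
have xd : \forall y \near x, (`|x - y| < (`|M| + 1)^-1 * e)%R.
  by have /cvgrPdist_lt/(_ _ d0) : y @[y --> x] --> x by exact: cvg_id.
near=> y.
have Ey : E y by apply: interior_space; near: y; exact: near_state_interior.
have /= := AB (x, y) (conj (nbhs_singleton xA) _) (conj Ex Ey).
rewrite /self_sub /= => /(_ _)/le_lt_trans; apply.
  by near: y.
by rewrite -ltr_pdivlMl//; near: y.
Unshelve. all: by end_near. Qed.

Lemma velocity_inv_continuous x : I x -> {for x, continuous (fun y => (r y)^-1)%R}.
Proof.
move=> Ix; apply: continuousV; last exact: velocity_continuous.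
by rewrite gt_eqF// (flow_velocity_gt0 flow).
Qed.

(** The time that the flow takes per unit of space. *)
Definition slowness : R -> R := (fun x => (r x)^-1)%R \_ I.

Lemma slowness_ge0 x : (0 <= slowness x)%R.
Proof.
rewrite /slowness patchE; case: ifPn => // /set_mem Ix.
by rewrite invr_ge0 ltW// (flow_velocity_gt0 flow).
Qed.

Lemma measurable_slowness : measurable_fun [set: R] slowness.
Proof.
apply/(measurable_restrictT _ measurable_state_interior).
apply: open_continuous_measurable_fun; first exact: open_state_interior.
by move=> x /set_mem; exact: velocity_inv_continuous.
Qed.

Lemma hitting_time_ge0 x : 0 <= tau x.
Proof. by apply: le_ereal_inf_tmp => _ [t [t0 _] <-]; rewrite lee_fin. Qed.

Lemma hitting_time_pinfty x : gamma = +oo -> tau x = +oo.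
Proof.
move=> gy; rewrite /hitting_time (_ : [set _ | _ in _] = set0) ?ereal_inf0//.
by apply/seteqP; split => // y [t [_]]; rewrite gy.
Qed.

Lemma state_space_lt x : E x -> x%:E < gamma.
Proof. by move=> /andP[]. Qed.

Lemma hitting_time_gt0 x : E x -> 0 < tau x.
Proof.
move=> Ex; rewrite lt_neqAle hitting_time_ge0 andbT; apply/eqP => t0.
have [gy|gy] := ltP gamma +oo; last first.
  by move: t0; rewrite hitting_time_pinfty//; apply/eqP; rewrite -leye_eq.
have [_] := flow_hits flow Ex gy; rewrite -t0 /= (flow0 flow)// => xg.
by have := state_space_lt Ex; rewrite -xg ltxx.
Qed.

Lemma near_hitting_time x t : t%:E < tau x -> \forall s \near t, s%:E < tau x.
Proof.
case: (tau x) => [u| |]//; rewrite ?lte_fin => tu; near=> s.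
  by rewrite lte_fin; near: s; exact: lt_nbhsl.
by rewrite ltry.
Unshelve. all: by end_near. Qed.

Lemma flow_ge x t : E x -> (0 <= t)%R -> t%:E <= tau x -> (x <= phi x t)%R.
Proof.
rewrite le_eqVlt => Ex /predU1P[<- _|t0 tx]; first by rewrite (flow0 flow).
by rewrite -{1}(flow0 flow Ex) ltW// (flow_increasing flow).
Qed.

Lemma flow_interior x t : E x -> (0 < t)%R -> t%:E < tau x -> I (phi x t).
Proof.
move=> Ex t0 tx; apply/andP; split; last first.
  by apply/state_space_lt/(flow_in flow) => //; exact: ltW.
have /andP[wx _] := Ex; rewrite (le_lt_trans wx)// lte_fin.
by rewrite -{1}(flow0 flow Ex) (flow_increasing flow)// ltW.
Qed.

Lemma flow_is_derive x t : E x -> (0 < t)%R -> t%:E < tau x ->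
  is_derive t 1%R (phi x) (r (phi x t)).
Proof.
move=> Ex t0 tx.
have quotient : ((phi x s - phi x t) / (s - t))%R @[s --> t^'] --> r (phi x t).
  apply: cvg_trans (flow_derive flow Ex (ltW t0) tx).
  apply: cvg_app => A tA.
  have {}tA : t^' (fun s => (0 <= s)%R -> A s) := tA.
  suff : t^' A by [].
  apply: filterS2 tA (nbhs_dnbhs (lt_nbhsr t0)) => s sA /ltW s0; exact: sA.
have to_t : (h + t)%R @[h --> (0%R : R)^'] --> t^'.
  rewrite -[X in _ --> dnbhs X]add0r.
  apply: (@continuous_injective_withinNx R R (fun h => h + t)%R); last first.
    by move=> y /addIr.
  by apply: cvgD; [exact: cvg_id|exact: cvg_cst].
have dphi : (h^-1 *: ((phi x \o shift t) (h *: 1) - phi x t))%R @[h --> (0%R : R)^'] --> r (phi x t).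
  move/(cvg_comp _ _ to_t): quotient; apply: cvg_trans; apply: near_eq_cvg.
  near=> h; rewrite /= addrK -[(h *: 1)%R]/(h * 1)%R mulr1.
  by rewrite mulrC -[LHS]/(_ *: _)%R.
by apply: DeriveDef; [apply/cvg_ex; exists (r (phi x t))|apply/cvg_lim].
Unshelve. all: by end_near. Qed.

Lemma flow_continuous_at x t : E x -> (0 < t)%R -> t%:E < tau x ->
  {for t, continuous (phi x)}.
Proof.
move=> Ex t0 tx; apply: differentiable_continuous.
by apply/derivable1_diffP; apply: ex_derive; exact: flow_is_derive.
Qed.

Lemma flow_derive1_continuous x t : E x -> (0 < t)%R -> t%:E < tau x ->
  {for t, continuous (derive1 (phi x))}.
Proof.
move=> Ex t0 tx.
have dphi : \forall s \near t, (r \o phi x) s = derive1 (phi x) s.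
  near=> s; rewrite derive1E /=; apply/esym/derive_val/flow_is_derive => //.
    by near: s; exact: lt_nbhsr.
  by near: s; exact: near_hitting_time.
rewrite /prop_for /continuous_at -(nbhs_singleton dphi).
apply: cvg_trans; last first.
  apply: continuous_comp; first exact: flow_continuous_at Ex t0 tx.
  exact/velocity_continuous/flow_interior.
exact: near_eq_cvg.
Unshelve. all: by end_near. Qed.

Lemma slownessE x : I x -> slowness x = (r x)^-1%R.
Proof. by move=> Ix; rewrite /slowness patchE mem_set. Qed.

(** Substitution of phi x u for y: its derivative in u cancels 1 / r. The
times are positive because at time 0 the flow has only a one-sided derivative. *)
Lemma slowness_integral_flow x s t : E x -> (0 < s)%R -> (s <= t)%R ->
  t%:E < tau x ->
  \int[leb]_(y in `[phi x s, phi x t]) (slowness y)%:E = (t - s)%:E.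
Proof.
move=> Ex s0 st tx.
have ltx u : (u <= t)%R -> u%:E < tau x.
  by move=> ut; rewrite (le_lt_trans _ tx)// lee_fin.
have sub u : u \in `[s, t] -> (0 < u)%R /\ u%:E < tau x.
  by rewrite in_itv/= => /andP[su ut]; rewrite (lt_le_trans s0 su) ltx.
have phiI y : y \in `[phi x s, phi x t] -> I y.
  have /andP[wx _] := flow_interior Ex s0 (ltx _ st).
  have /andP[_ xg] := flow_interior Ex (lt_le_trans s0 st) tx.
  rewrite in_itv/= => /andP[sy yt]; apply/andP; split.
    by rewrite (lt_le_trans wx)// lee_fin.
  by rewrite (le_lt_trans _ xg)// lee_fin.
transitivity (\int[leb]_(y in `[phi x s, phi x t]) ((r y)^-1)%:E).
  by apply: eq_integral => y /set_mem/phiI Iy; rewrite slownessE.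
rewrite (integration_by_substitution_increasing st).
- transitivity (\int[leb]_(u in `[s, t]) (cst 1 u)).
    apply: eq_integral => u /set_mem/sub[u0 ux].
    rewrite /= fctE derive1E (@derive_val _ _ _ _ _ _ _ (flow_is_derive Ex u0 ux)).
    rewrite /= mulVf// gt_eqF//; apply: (flow_velocity_gt0 flow).
    exact: flow_interior.
  rewrite integral_cst//= mul1e lebesgue_measure_itv/= lte_fin -EFinD.
  by case: ltP => // ts; rewrite (le_anti (introT andP (conj st ts))) subrr.
- move=> u v us vs uv; apply: (flow_increasing flow) => //.
    by rewrite ltW// (sub _ us).1.
  by rewrite ltW// (sub _ vs).2.
- move=> u us; have [u0 ux] := sub _ (subset_itv_oo_cc us).
  exact: flow_derive1_continuous.
- apply/cvg_ex; exists (derive1 (phi x) s); apply: cvg_at_right_filter.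
  by apply: flow_derive1_continuous => //; exact: ltx.
- apply/cvg_ex; exists (derive1 (phi x) t); apply: cvg_at_left_filter.
  by apply: flow_derive1_continuous => //; exact: lt_le_trans st.
- split.
  + move=> u us; have [u0 ux] := sub _ (subset_itv_oo_cc us).
    by apply: ex_derive; exact: flow_is_derive.
  + by apply: cvg_at_right_filter; apply: flow_continuous_at => //; exact: ltx.
  + apply: cvg_at_left_filter; apply: flow_continuous_at => //.
    exact: lt_le_trans st.
- apply: continuous_in_subspaceT => y /set_mem yI.
  exact/velocity_inv_continuous/phiI.
Qed.

(** The time that the flow takes from [z] to [x], see [clock_flow]. *)
Definition clock (z : R) (x : \bar R) : \bar R :=
  \int[leb]_(y in [set y : R | z%:E <= y%:E < x]) (slowness y)%:E.

Let measurable_clock_dom (z : R) (x : \bar R) :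
  measurable [set y : R | z%:E <= y%:E < x].
Proof.
rewrite (_ : [set _ | _] = [set y : R | z%:E <= y%:E] `&` [set y | y%:E < x]).
  apply: measurableI; rewrite -[X in measurable X]setTI.
    exact: measurable_lee.
  exact: measurable_lte.
by apply/seteqP; split => y => [/andP[]|[? ?]]//; apply/andP.
Qed.

Let measurable_slownessE (D : set R) :
  measurable_fun D (fun y => (slowness y)%:E).
Proof.
by apply/measurable_EFinP; apply: measurable_funTS; exact: measurable_slowness.
Qed.

Lemma clock_ge0 z x : 0 <= clock z x.
Proof. by apply: integral_ge0 => y _; rewrite lee_fin slowness_ge0. Qed.

Lemma clock_le z x y : x <= y -> clock z x <= clock z y.
Proof.
move=> xy; apply: ge0_subset_integral.
- exact: measurable_clock_dom.
- exact: measurable_clock_dom.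
- exact: measurable_slownessE.
- by move=> u _; rewrite lee_fin slowness_ge0.
by move=> u /andP[zu ux]; apply/andP; split=> //; exact: lt_le_trans xy.
Qed.

Lemma clock_eq0 z x : x <= z%:E -> clock z x = 0.
Proof.
move=> xz; rewrite /clock (_ : [set _ | _] = set0) ?integral_set0//.
apply/seteqP; split => // y /andP[zy yx].
by have := lt_le_trans yx (le_trans xz zy); rewrite ltxx.
Qed.

Lemma clock_split z y x : (z <= y)%R -> y%:E <= x ->
  clock z x = clock z y%:E + clock y x.
Proof.
move=> zy yx; rewrite /clock -ge0_integral_setU; last 5 first.
- exact: measurable_clock_dom.
- exact: measurable_clock_dom.
- exact: measurable_slownessE.
- by move=> u _; rewrite lee_fin slowness_ge0.
- apply/disj_setPS => u /= [/andP[_ uy] /andP[yu _]].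
  by have := lt_le_trans uy yu; rewrite ltxx.
congr integral; apply/seteqP; split => u /=.
    move=> /andP[zu ux]; case: (ltP u y) => [uy|yu].
      by left; rewrite zu lte_fin.
    by right; rewrite ux lee_fin yu.
  move=> [/andP[zu uy]|/andP[yu ux]]; apply/andP; split => //.
    exact: lt_le_trans yx.
  by rewrite lee_fin (le_trans zy).
Qed.

Lemma clockE z x : clock z x%:E = \int[leb]_(y in `[z, x[) (slowness y)%:E.
Proof. by []. Qed.

Lemma flow_cvg_right z u : E z -> (0 <= u)%R -> u%:E < tau z ->
  phi z s @[s --> u^'+] --> phi z u.
Proof.
move=> Ez u0 uz; have /subspace_continuousP := flow_continuous flow Ez.
move=> /(_ u (conj u0 (ltW uz))); apply: cvg_trans; apply: cvg_app => A uA.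
have {}uA : \forall s \near u, (0 <= s)%R /\ s%:E <= tau z -> A s := uA.
suff : u^'+ A by [].
near=> s; have us : (u < s)%R by near: s; exact: nbhs_right_gt.
have sz : s%:E < tau z.
  by near: s; apply: cvg_within; exact: near_hitting_time.
have sA : (0 <= s)%R /\ s%:E <= tau z -> A s.
  by near: s; apply: cvg_within; exact: uA.
by apply: sA; split; [rewrite (le_trans u0)// ltW|exact: ltW].
Unshelve. all: by end_near. Qed.

(** The substitution applies from the times t / n.+1 on; as they tend to 0, the
starting point is recovered by right continuity. *)
Lemma clock_flow z t : E z -> (0 <= t)%R -> t%:E < tau z ->
  clock z (phi z t)%:E = t%:E.
Proof.
move=> Ez; rewrite le_eqVlt => /predU1P[<- _|t0 tz].
  by rewrite (flow0 flow)// clock_eq0.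
pose s n : R := (t / n.+1%:R)%R.
have s0 n : (0 < s n)%R by rewrite divr_gt0.
have st n : (s n <= t)%R by rewrite ler_pdivrMr// ler_peMr ?(ltW t0)// ler1n.
have stau n : (s n)%:E < tau z by rewrite (le_lt_trans _ tz)// lee_fin.
have scvg : s n @[n --> \oo] --> (0%R : R).
  by rewrite -(mulr0 t); apply: cvgM; [exact: cvg_cst|exact: cvg_harmonic].
pose F n : set R := `[phi z (s n), phi z t[%classic.
have ndF : nondecreasing_seq F.
  move=> m n mn; apply/subsetPset => y; rewrite /F /= !in_itv/= => /andP[my ->].
  rewrite andbT (le_trans _ my)//.
  have : (s n <= s m)%R by rewrite ler_pM2l// lef_pV2 ?posrE// ler_nat.
  rewrite (le_eqVlt (s n)) => /predU1P[->//|snm].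
  by rewrite ltW// (flow_increasing flow)// ltW.
have UF : \bigcup_n F n = `]z, phi z t[%classic.
  apply/seteqP; split => y.
    move=> [n _]; rewrite /F /= !in_itv/= => /andP[ny ->]; rewrite andbT.
    rewrite (lt_le_trans _ ny)// -{1}(flow0 flow Ez).
    by rewrite (flow_increasing flow)// ltW.
  rewrite /= in_itv/= => /andP[zy yt].
  have : \forall u \near (0%R : R)^'+, (phi z u < y)%R.
    have := flow_cvg_right Ez (lexx 0%R) (hitting_time_gt0 Ez).
    by rewrite (flow0 flow Ez) => /cvgr_lt; exact.
  move=> /scvg [n _ ny].
  exists n => //; rewrite /F /= in_itv/= yt andbT ltW//.
  exact: ny (leqnn n) (s0 n).
have limF : \int[leb]_(y in F n) (slowness y)%:E @[n --> \oo]
    --> \int[leb]_(y in `]z, phi z t[) (slowness y)%:E.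
  rewrite -UF; apply: ge0_nondecreasing_set_cvg_integral => //.
  - by move=> n; exact: measurable_itv.
  - by move=> n; exact: measurable_slownessE.
  - by move=> n y _; rewrite lee_fin slowness_ge0.
rewrite clockE -integral_itv_obnd_cbnd; last exact: measurable_slownessE.
apply: (cvg_unique _ limF) => //.
have -> : (fun n => \int[leb]_(y in F n) (slowness y)%:E) =
    EFin \o (fun n => t - s n)%R.
  apply/funext => n /=; rewrite -(slowness_integral_flow Ez)//.
  by rewrite integral_itv_bndo_bndc//; exact: measurable_slownessE.
apply: cvg_EFin; first exact: nearW.
rewrite -[X in _ --> X]subr0; apply: cvgB; first exact: cvg_cst.
exact: scvg.
Qed.

Lemma flow_hitting_time z u : E z -> tau z = u%:E -> (phi z u)%:E = gamma.
Proof.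
move=> Ez zu; have [gy|gy] := ltP gamma +oo.
  by have [_] := flow_hits flow Ez gy; rewrite zu.
by move: zu; rewrite hitting_time_pinfty//; apply/eqP; rewrite -leye_eq.
Qed.

(** At the hitting time itself, which the differential equation does not cover,
the formula follows from the continuity of the path. *)
Lemma flow_le_hitting_time z t : E z -> (0 <= t)%R -> t%:E <= tau z ->
  clock z (phi z t)%:E = t%:E.
Proof.
move=> Ez t0; rewrite le_eqVlt => /predU1P[ztau|]; last exact: clock_flow.
have {}t0 : (0 < t)%R by have := hitting_time_gt0 Ez; rewrite -ztau lte_fin.
pose s n : R := (t - t / n.+1%:R)%R.
have s0 n : (0 <= s n)%R.
  by rewrite subr_ge0 ler_pdivrMr// ler_peMr ?(ltW t0)// ler1n.
have st n : (s n < t)%R by rewrite ltrBlDr ltrDl divr_gt0.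
have stau n : (s n)%:E < tau z by rewrite -ztau lte_fin.
have scvg : s n @[n --> \oo] --> t.
  rewrite -[X in _ --> X]subr0; apply: cvgB; first exact: cvg_cst.
  by rewrite -(mulr0 t); apply: cvgM; [exact: cvg_cst|exact: cvg_harmonic].
pose F n : set R := `[z, phi z (s n)[%classic.
have ndF : nondecreasing_seq F.
  move=> m n mn; apply/subsetPset => y; rewrite /F /= !in_itv/= => /andP[-> ym].
  rewrite (lt_le_trans ym)//=.
  have : (s m <= s n)%R by rewrite lerB// ler_pM2l// lef_pV2 ?posrE// ler_nat.
  rewrite (le_eqVlt (s m)) => /predU1P[->//|smn].
  by rewrite ltW// (flow_increasing flow)// ltW.
have UF : \bigcup_n F n = `[z, phi z t[%classic.
  apply/seteqP; split => y.
    move=> [n _]; rewrite /F /= !in_itv/= => /andP[-> yn].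
    by rewrite (lt_trans yn)// (flow_increasing flow)// ztau.
  rewrite /= in_itv/= => /andP[zy yt].
  have : phi z u @[u --> within [set u | (0 <= u)%R /\ u%:E <= tau z] (nbhs t)]
      --> phi z t.
    have /subspace_continuousP := flow_continuous flow Ez; apply.
    by rewrite /= ztau lexx ltW.
  move=> /cvgr_gt/(_ _ yt) phiy.
  have {}phiy : \forall u \near t, (0 <= u)%R /\ u%:E <= tau z -> (y < phi z u)%R.
    exact: phiy.
  have [n _ ny] := scvg _ phiy.
  exists n => //; rewrite /F /= in_itv/= zy /=.
  exact: ny (leqnn n) (conj (s0 n) (ltW (stau n))).
have limF : \int[leb]_(y in F n) (slowness y)%:E @[n --> \oo]
    --> \int[leb]_(y in `[z, phi z t[) (slowness y)%:E.
  rewrite -UF; apply: ge0_nondecreasing_set_cvg_integral => //.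
  - by move=> n; exact: measurable_itv.
  - by move=> n; exact: measurable_slownessE.
  - by move=> n y _; rewrite lee_fin slowness_ge0.
rewrite clockE; apply: (cvg_unique _ limF) => //.
have -> : (fun n => \int[leb]_(y in F n) (slowness y)%:E) = EFin \o s.
  by apply/funext => n /=; rewrite -clockE clock_flow.
by apply: cvg_EFin; [exact: nearW|exact: scvg].
Qed.

(** If gamma is out of reach, the flow runs for arbitrarily long times, all of
which are below the clock of gamma, which is thus infinite. *)
Lemma clock_boundary z : E z -> clock z gamma = tau z.
Proof.
move=> Ez; have := hitting_time_gt0 Ez.
case tauz : (tau z) => [u| |]// u0.
  by rewrite -(flow_hitting_time Ez tauz) flow_le_hitting_time// ?tauz// ltW.
apply/eqP; rewrite -leye_eq leNgt; apply/negP => czy.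
have czfin : clock z gamma \is a fin_num by rewrite ge0_fin_numE ?clock_ge0.
have c0 : (0 <= fine (clock z gamma))%R by rewrite fine_ge0// clock_ge0.
have := @clock_flow z (fine (clock z gamma) + 1)%R Ez.
rewrite tauz ltry addr_ge0// => /(_ isT isT) cE.
have : clock z (phi z (fine (clock z gamma) + 1))%:E <= clock z gamma.
  apply: clock_le; apply/ltW/state_space_lt/(flow_in flow) => //.
    by rewrite addr_ge0.
  by rewrite tauz ltry.
by rewrite cE -{2}(fineK czfin) lee_fin gerDl ler10.
Qed.

(** Comparing positions amounts to comparing times; this makes the flow jointly
measurable, since the clock is an integral depending on a parameter. For the
strict inequality, right continuity gives room for a slightly later time. *)
Lemma flow_ltE z u x : E z -> (0 <= u)%R -> u%:E < tau z ->
  (phi z u < x)%R = (u%:E < clock z x%:E).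
Proof.
move=> Ez u0 uz; have [xphi|phix] := leP x (phi z u).
  apply/esym/negbTE; rewrite -leNgt -(clock_flow Ez u0 uz).
  by apply: clock_le; rewrite lee_fin.
apply/esym.
have [s [us sz phis]] : exists s, [/\ (u < s)%R, s%:E < tau z & (phi z s < x)%R].
  have : \forall s \near u^'+, (phi z s < x)%R.
    by have /cvgr_lt := flow_cvg_right Ez u0 uz; exact.
  move=> near_lt; have : \forall s \near u^'+, s%:E < tau z.
    by apply: cvg_within; exact: near_hitting_time.
  move=> near_tau.
  near u^'+ => s; exists s.
  by split; near: s => //; exact: nbhs_right_gt.
apply: (@lt_le_trans _ _ s%:E); first by rewrite lte_fin.
rewrite -(clock_flow Ez (le_trans u0 (ltW us)) sz).
by apply: clock_le; rewrite lee_fin ltW.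
Unshelve. all: by end_near. Qed.

(** The time that the flow takes to cross the part of [a, b) below [y], as an
integral over the levels of [a, b), so that it can be exchanged with
expectations. *)
Definition rise (a b y : R) : \bar R :=
  \int[leb]_(x in `[a, b[) ((x <= y)%R%:R * slowness x)%:E.

Lemma rise_clock a b y : (a <= b)%R ->
  rise a b y = clock a (Order.min b y)%:E.
Proof.
move=> ab; rewrite /rise clockE.
have -> : \int[leb]_(x in `[a, b[) ((x <= y)%R%:R * slowness x)%:E =
    \int[leb]_(x in `[a, b[ `&` `]-oo, y]) (slowness x)%:E.
  rewrite integral_mkcondr; apply: eq_integral => x _.
  rewrite patchE mem_setE in_itv/=.
  by case: ifPn => xy; rewrite ?mul1r ?(negbTE xy) ?mul0r.
have [by_|yb] := leP b y.
  congr integral; apply/seteqP; split => x /=; rewrite !in_itv/=; first by case.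
  by move=> /andP[ax xb]; rewrite ax xb (le_trans (ltW xb)).
rewrite (_ : `[a, b[ `&` `]-oo, y] = `[a, y])%classic; last first.
  apply/seteqP; split => x /=; rewrite !in_itv/=; first by case => /andP[-> _].
  by move=> /andP[ax xy]; rewrite ax xy (le_lt_trans xy).
by apply: esym; apply: integral_itv_bndo_bndc; exact: measurable_slownessE.
Qed.

Lemma rise_ge0 a b y : 0 <= rise a b y.
Proof.
apply: integral_ge0 => x _; rewrite lee_fin mulr_ge0// ?slowness_ge0//.
Qed.

(** Read on the clock, the visit of the flow to [a, b) is an interval. *)
Lemma clock_occupation z v a b : E z -> (0 <= v)%R -> v%:E <= tau z ->
  (a <= b)%R ->
  clock z (Order.min b (phi z v))%:E = clock z (Order.min a (phi z v))%:E +
    leb [set u | (0 <= u < v)%R /\ (a <= phi z u < b)%R].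
Proof.
move=> Ez v0 vz ab; pose c x := fine (clock z (Order.min x (phi z v))%:E).
have clock_v := flow_le_hitting_time Ez v0 vz.
have c_le_v x : clock z (Order.min x (phi z v))%:E <= v%:E.
  by rewrite -clock_v; apply: clock_le; rewrite lee_fin ge_min lexx orbT.
have cE x : clock z (Order.min x (phi z v))%:E = (c x)%:E.
  by rewrite fineK// ge0_fin_numE ?clock_ge0// (le_lt_trans (c_le_v x))// ltry.
have c_mono x y : (x <= y)%R -> (c x <= c y)%R.
  move=> xy; rewrite -lee_fin -!cE; apply: clock_le; rewrite lee_fin.
  by rewrite le_min !ge_min xy lexx orbT.
have c_lt u x : (0 <= u < v)%R -> (phi z u < x)%R = (u < c x)%R.
  move=> /andP[u0 uv]; have uz : u%:E < tau z by rewrite (lt_le_trans _ vz)// lte_fin.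
  rewrite -[RHS]lte_fin -cE -flow_ltE// lt_min.
  by rewrite (flow_increasing flow Ez u0 uv vz) andbT.
rewrite !cE (_ : [set _ | _] = `[c a, c b[%classic); last first.
  apply/seteqP; split => u /=; rewrite in_itv/=.
    by move=> [uv]; rewrite leNgt !c_lt// -leNgt.
  move=> /andP[au ub]; have uv : (0 <= u < v)%R.
    rewrite (le_trans _ au) -?lee_fin -?cE ?clock_ge0//=.
    by rewrite (lt_le_trans ub)// -lee_fin -cE.
  by split => //; rewrite leNgt !c_lt// -leNgt au.
rewrite lebesgue_measure_itv/= lte_fin; case: ltP => [_|ba].
  by rewrite -!EFinD; congr _%:E; lra.
by rewrite adde0; congr _%:E; apply/le_anti; rewrite ba c_mono.
Qed.

(** The flow crosses each piece of space in the time given by its slowness,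
whatever its starting point. *)
Lemma rise_occupation z v a b : E z -> (0 <= v)%R -> v%:E <= tau z ->
  (a <= b)%R ->
  rise a b (phi z v) = rise a b z +
    leb [set u | (0 <= u < v)%R /\ (a <= phi z u < b)%R].
Proof.
move=> Ez v0 vz ab; rewrite !rise_clock//.
have := clock_occupation Ez v0 vz ab; set L := leb _ => clockL.
have clock_v := flow_le_hitting_time Ez v0 vz.
have zphi : (z <= phi z v)%R by exact: flow_ge.
have finL x : (x <= phi z v)%R -> clock z x%:E \is a fin_num.
  move=> xv; rewrite ge0_fin_numE ?clock_ge0//.
  by rewrite (@le_lt_trans _ _ v%:E) ?ltry// -clock_v clock_le.
have [za|az] := leP z a.
  rewrite [X in _ = X + _]clock_eq0 ?add0e ?lee_fin ?ge_min ?za ?orbT//.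
  have [va|av] := leP (phi z v) a.
    move: clockL; rewrite (min_r va) (min_r (le_trans va ab)).
    rewrite [clock a _]clock_eq0 ?lee_fin// -{1}[clock z _]adde0.
    by apply: adde_injl; exact: finL.
  move: clockL; rewrite (min_l (ltW av)) (@clock_split z a _) ?lee_fin ?le_min ?ab ?(ltW av)//.
  by apply: adde_injl; rewrite finL// ltW.
move: clockL; rewrite (min_l (le_trans (ltW az) zphi)) [X in _ = X + _]clock_eq0 ?lee_fin ?ltW// add0e => <-.
have [bz|zb] := leP b z.
  by rewrite !(min_l (le_trans bz _))// [X in _ = _ + X]clock_eq0 ?adde0.
by rewrite (@clock_split a z _ (ltW az))// lee_fin le_min zphi ltW.
Qed.

Local Notation T := (measurableTypeR R).

Lemma measurable_clock x : measurable_fun [set: T] (clock ^~ x).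
Proof.
pose f (p : T * T) : \bar R :=
  (\1_[set p : T * T | p.1%:E <= p.2%:E :> \bar R]%E p *
   (\1_[set y : R | y%:E < x]%E p.2 * slowness p.2))%:E.
rewrite (_ : clock ^~ x = fun z => \int[leb]_y f (z, y)); last first.
  apply/funext => z; rewrite /clock integral_mkcond; apply: eq_integral => y _.
  rewrite patchE /f !indicE !mem_setb [(z, y).1]/= [(z, y).2]/=.
  by case: (z%:E <= _); case: (y%:E < x); rewrite ?mul1r ?mul0r ?mulr0.
apply: (@measurable_fun_fubini_tonelli_F _ _ T T R leb f).
  apply/measurable_EFinP; apply: measurable_funM.
    apply: measurable_indic; rewrite -[X in measurable X]setTI.
    by apply: measurable_lee => //; apply/measurable_EFinP.
  apply: (@measurableT_comp _ _ _ _ _ _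
    (fun y : T => (\1_[set y : R | y%:E < x]%E y * slowness y)%R : R) _ snd) => //.
  apply: measurable_funM; last exact: measurable_slowness.
  apply: measurable_indic; rewrite -[X in measurable X]setTI.
  exact: measurable_lte.
by move=> p; rewrite lee_fin !mulr_ge0// slowness_ge0.
Qed.

Definition flow_dom : set (T * T) :=
  [set p : T * T | E p.1 /\ (0 <= p.2)%R /\ p.2%:E < tau p.1].

Lemma measurable_flow_dom : measurable flow_dom.
Proof.
rewrite (_ : flow_dom = (E `*` [set: T]) `&` ([set p : T * T | 0 <= p.2%:E :> \bar R] `&`
    [set p : T * T | p.2%:E < clock p.1 gamma])); last first.
  apply/seteqP; split => -[z u] /=.
    by move=> [Ez [u0 uz]]; rewrite lee_fin clock_boundary.
  by rewrite lee_fin => -[[Ez _] [u0]]; rewrite clock_boundary.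
apply: measurableI; first by apply: measurableX => //; exact: measurable_state_space.
apply: measurableI; rewrite -[X in measurable X]setTI.
  by apply: measurable_lee => //; apply/measurable_EFinP.
apply: measurable_lte => //; first exact/measurable_EFinP.
exact: measurableT_comp (measurable_clock gamma) _.
Qed.

Lemma measurable_flow :
  measurable_fun flow_dom (fun p : T * T => phi p.1 p.2 : T).
Proof.
move=> mD; apply: (measurability _ (RGenInftyO.measurableE R)) => //.
move=> _ [_ [x ->] <-].
rewrite (_ : _ `&` _ = flow_dom `&` [set p : T * T | p.2%:E < clock p.1 x%:E]).
  apply: measurableI => //; rewrite -[X in measurable X]setTI.
  apply: measurable_lte => //; first exact/measurable_EFinP.
  exact: measurableT_comp (measurable_clock _) _.
apply/seteqP; split => -[z u] /= [[Ez [u0 uz]]]; rewrite in_itv/=.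
  by rewrite flow_ltE.
by rewrite flow_ltE.
Qed.

(** * The survival function along the flow *)

Section survival.
Variable lambda : R -> R.
Hypotheses (lambda_measurable : measurable_fun E lambda)
  (lambda_ge0 : forall x, E x -> (0 <= lambda x)%R)
  (lambda_continuous : {within E, continuous lambda}).

Definition flow_rate : T * T -> R :=
  (fun p => lambda (phi p.1 p.2)) \_ flow_dom.

Lemma flow_rateE z u : flow_dom (z, u) -> flow_rate (z, u) = lambda (phi z u).
Proof. by move=> zu; rewrite /flow_rate patchE mem_set. Qed.

Lemma flow_rate_eq0 z u : ~ flow_dom (z, u) -> flow_rate (z, u) = 0%R.
Proof. by move=> zu; rewrite /flow_rate patchE memNset. Qed.

Lemma flow_rate_ge0 p : (0 <= flow_rate p)%R.
Proof.
rewrite /flow_rate patchE; case: ifPn => // /set_mem[Ep [p0 ptau]].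
by apply: lambda_ge0; exact: (flow_in flow).
Qed.

Lemma measurable_flow_rate : measurable_fun [set: T * T] flow_rate.
Proof.
apply/(measurable_restrictT _ measurable_flow_dom).
apply: (@measurable_comp _ _ _ _ _ _ E lambda) => //.
- exact: measurable_state_space.
- by move=> _ [[z u] [Ez [u0 uz]] <-]; exact: (flow_in flow).
- exact: measurable_flow.
Qed.

Definition cumulated_rate (p : T * T) : R :=
  fine (\int[leb]_s ((0 <= s <= p.2)%R%:R * flow_rate (p.1, s))%:E).

Definition survival_fun : T * T -> R :=
  (fun p => expR (- cumulated_rate p)) \_ flow_dom.

Lemma survival_fun_ge0 p : (0 <= survival_fun p)%R.
Proof. by rewrite /survival_fun patchE; case: ifPn => // _; exact: expR_ge0. Qed.

Lemma measurable_survival_fun : measurable_fun [set: T * T] survival_fun.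
Proof.
apply/(measurable_restrictT _ measurable_flow_dom); apply: measurable_funTS.
apply: measurableT_comp; first exact: measurable_expR.
apply: measurableT_comp => //; apply: measurableT_comp; first exact: fine_measurable.
pose f (q : (T * T) * T) : \bar R :=
  (\1_[set q : (T * T) * T | (0 <= q.2)%R && (q.2 <= q.1.2)%R] q *
   flow_rate (q.1.1, q.2))%:E.
rewrite (_ : (fun _ => _) = fun p => \int[leb]_s f (p, s)); last first.
  by apply/funext => -[z u]; apply: eq_integral => s _; rewrite /f indicE mem_setb.
apply: (@measurable_fun_fubini_tonelli_F _ _ (T * T)%type T R leb f).
  apply/measurable_EFinP; apply: measurable_funM.
    apply: measurable_indic.
    rewrite (_ : [set _ | _] = [set q : (T * T) * T | 0 <= q.2%:E :> \bar R]%E `&`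
        [set q | q.2%:E <= q.1.2%:E :> \bar R]%E).
      apply: measurableI; rewrite -[X in measurable X]setTI.
        by apply: measurable_lee => //; apply/measurable_EFinP.
      apply: measurable_lee => //; apply/measurable_EFinP => //.
      exact: measurableT_comp.
    by apply/seteqP; split => q /=; rewrite !lee_fin => /andP.
  apply: measurableT_comp; first exact: measurable_flow_rate.
  by apply: measurable_fun_pair => //; exact: measurableT_comp.
by move=> q; rewrite lee_fin mulr_ge0// flow_rate_ge0.
Qed.

Lemma flow_dom_le z u s : flow_dom (z, u) -> (0 <= s <= u)%R -> flow_dom (z, s).
Proof.
move=> [Ez [_ uz]] /andP[s0 su]; split => //; split => //=.
by rewrite (le_lt_trans _ uz)// lee_fin.
Qed.

Lemma flow_rate_within z v : flow_dom (z, v) ->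
  {within `[0%R, v], continuous (lambda \o phi z)}.
Proof.
move=> zv; have [/= Ez [v0 vz]] := zv.
apply/subspace_continuousP => t; rewrite /= in_itv/= => tv.
have [/= _ [t0 tz]] := flow_dom_le zv tv.
have phit : E (phi z t) by exact: (flow_in flow).
have /subspace_continuousP/(_ _ phit) := lambda_continuous.
apply: cvg_comp => A phiA.
have {}phiA : \forall y \near phi z t, E y -> A y := phiA.
suff : \forall s \near t, (0 <= s <= v)%R -> A (phi z s).
  move=> At; suff : \forall s \near t, s \in `[0%R, v] -> A (phi z s) by [].
  by apply: filterS At => s; rewrite in_itv.
have /subspace_continuousP/(_ t (conj t0 (ltW tz))) := flow_continuous flow Ez.
move=> /(_ _ phiA) phit_near.
have {}phit_near : \forall s \near t, (0 <= s)%R /\ s%:E <= tau z ->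
  E (phi z s) -> A (phi z s) := phit_near.
apply: filterS phit_near => s sA sv; have [/= _ [s0 sz]] := flow_dom_le zv sv.
by apply: sA; [split=> //; exact: ltW|exact: (flow_in flow)].
Qed.

Lemma cumulated_rateE z v : flow_dom (z, v) ->
  cumulated_rate (z, v) = (\int[leb]_(s in `[0%R, v]) lambda (phi z s))%R.
Proof.
move=> zv; rewrite /cumulated_rate /Rintegral [in RHS]integral_mkcond.
congr fine; apply: eq_integral => s _; rewrite patchE mem_setE in_itv/=.
case: ifPn => [sv|_]; last by rewrite mul0r.
by rewrite mul1r flow_rateE//; exact: flow_dom_le sv.
Qed.

Lemma flow_rate_integrable z v : flow_dom (z, v) ->
  leb.-integrable `[0%R, v] (EFin \o (lambda \o phi z)).
Proof.
move=> zv; apply: continuous_compact_integrable; first exact: segment_compact.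
exact: flow_rate_within.
Qed.

Lemma survival_funE z v : flow_dom (z, v) ->
  survival gamma phi lambda z v = (survival_fun (z, v))%:E.
Proof.
move=> zv; have [/= Ez [v0 vz]] := zv.
rewrite /survival vz /survival_fun patchE mem_set// cumulated_rateE//.
have /integrable_fin_num := flow_rate_integrable zv.
move=> /(_ (measurable_itv _)) fin_int.
by rewrite /Rintegral -[in LHS](fineK fin_int).
Qed.

Lemma survival_eq0 z v : ~ flow_dom (z, v) -> E z -> (0 <= v)%R ->
  survival gamma phi lambda z v = 0.
Proof.
move=> zv Ez v0; rewrite /survival; case: ifPn => // vz.
by exfalso; apply: zv.
Qed.

Lemma survivalE z v : E z -> (0 <= v)%R ->
  survival gamma phi lambda z v = (survival_fun (z, v))%:E.
Proof.
move=> Ez v0; have [zt|zt] := pselect (flow_dom (z, v)).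
  by rewrite survival_funE.
by rewrite survival_eq0// /survival_fun patchE memNset.
Qed.

(** Minus the derivative of the survival function in time. *)
Definition jump_density (p : T * T) : R := (flow_rate p * survival_fun p)%R.

Lemma jump_density_ge0 p : (0 <= jump_density p)%R.
Proof. by rewrite mulr_ge0// ?flow_rate_ge0// survival_fun_ge0. Qed.

Lemma measurable_jump_density : measurable_fun [set: T * T] jump_density.
Proof.
apply: measurable_funM; first exact: measurable_flow_rate.
exact: measurable_survival_fun.
Qed.

Lemma jump_density_out z u : ~ flow_dom (z, u) -> jump_density (z, u) = 0%R.
Proof. by move=> zu; rewrite /jump_density flow_rate_eq0// mul0r. Qed.

(** Fundamental theorem of calculus, lambda being continuous along the flow. *)
Lemma integral_jump_density z v : flow_dom (z, v) ->
  \int[leb]_(u in `[0%R, v]) (jump_density (z, u))%:E =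
  (1 - survival_fun (z, v))%:E.
Proof.
move=> zv; have [/= Ez [v0 vz]] := zv.
pose Lam u := (\int[leb]_(s in `[0%R, u]) (lambda \o phi z) s)%R.
have survE u : (0 <= u <= v)%R -> survival_fun (z, u) = expR (- Lam u).
  move=> uv; have zu := flow_dom_le zv uv.
  by rewrite /survival_fun patchE mem_set// cumulated_rateE.
have Lam0 : Lam 0%R = 0%R by rewrite /Lam set_itv1 Rintegral_set1.
move: (v0); rewrite le_eqVlt => /predU1P[v0E|{}v0].
  rewrite survE ?v0 ?lexx// -v0E set_itv1 integral_set1.
  by rewrite Lam0 oppr0 expR0 subrr.
transitivity (\int[leb]_(u in `[0%R, v])
    ((lambda \o phi z) u * expR (- Lam u))%:E).
  apply: eq_integral => u /set_mem; rewrite /= in_itv/= => uv.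
  by rewrite /jump_density survE// flow_rateE//; exact: flow_dom_le uv.
have Lam_within : {within `[0%R, v], continuous Lam}.
  exact: parameterized_integral_continuous (ltW v0) (flow_rate_integrable zv).
have rate_cont u : u \in `]0%R, v[ -> {for u, continuous (lambda \o phi z)}.
  by move=> uv; have /(continuous_within_itvP _ v0)[+ _ _] := flow_rate_within zv; exact.
have dLam u : u \in `]0%R, v[ -> is_derive u 1%R Lam (lambda (phi z u)).
  move=> uv; have := uv; rewrite in_itv/= => /andP[u0 u1].
  have [dL LE] := continuous_FTC1_closed u1 (flow_rate_integrable zv) u0 (rate_cont u uv).
  by apply: DeriveDef; [exact: dL|rewrite -derive1E; exact: LE].
clearbody Lam.
have exp_within : {within `[0%R, v], continuous (fun u => expR (- Lam u))}.
  move=> u; have Nu := @continuousN _ _ _ _ _ (Lam_within u).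
  exact: (@continuous_comp (subspace `[0%R, v]) R R (\- Lam)%R expR u Nu (@continuous_expR R _)).
have dF u : u \in `]0%R, v[ -> is_derive u 1%R (fun u => - expR (- Lam u))%R
    ((lambda \o phi z) u * expR (- Lam u))%R.
  move=> uv; have dLu := dLam u uv.
  have dN : is_derive u 1%R (fun u => - Lam u)%R (- lambda (phi z u))%R.
    exact: is_deriveN.
  have := @is_derive1_comp _ expR (fun u => - Lam u)%R u _ _ (is_derive_expR _) dN.
  move=> /is_deriveN; rewrite mulrN opprK mulrC; exact.
have F_within : {within `[0%R, v], continuous (fun u => - expR (- Lam u))%R}.
  by move=> u; exact: (@continuousN _ _ _ _ _ (exp_within u)).
have f_within : {within `[0%R, v],
    continuous ((lambda \o phi z) \* (fun u => expR (- Lam u)))%R}.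
  apply/subspace_continuousP => u uv; apply: cvgM.
    by have /subspace_continuousP := flow_rate_within zv; exact.
  by have /subspace_continuousP := exp_within; exact.
rewrite (@continuous_FTC2 _ _ (fun u => - expR (- Lam u))%R 0%R v)//.
- rewrite survE ?lexx ?(ltW v0)// Lam0 oppr0 expR0.
  by rewrite -EFinB opprK addrC.
- have /(continuous_within_itvP _ v0)[_ F0 Fv] := F_within; split.
  + by move=> u uv; have dFu := dF u uv; exact: (@ex_derive _ _ _ _ _ _ _ dFu).
  + exact: F0.
  + exact: Fv.
- move=> u uv; have dFu := dF u uv; rewrite derive1E.
  exact: (@derive_val _ _ _ _ _ _ _ dFu).
Qed.

Let measurable_densityE z (D : set T) :
  measurable_fun D (fun u : T => (jump_density (z, u))%:E).
Proof.
apply: measurable_funTS; apply/measurable_EFinP.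
by apply: measurableT_comp; [exact: measurable_jump_density|exact: measurable_pair1].
Qed.

(** By [integral_jump_density] the integrals up to the times t - t / n.+1, where
t is the hitting time, are at most 1, and they increase to the whole integral. *)
Lemma jump_density_mass z v : E z -> tau z <= v%:E ->
  \int[leb]_u (jump_density (z, u))%:E <= 1.
Proof.
move=> Ez zv; have := hitting_time_gt0 Ez.
case tauz : (tau z) => [t| |]//; last by move: zv; rewrite tauz leye_eq.
rewrite lte_fin => t0.
pose s n : R := (t - t / n.+1%:R)%R.
have s0 n : (0 <= s n)%R.
  by rewrite subr_ge0 ler_pdivrMr// ler_peMr ?(ltW t0)// ler1n.
have st n : (s n < t)%R by rewrite ltrBlDr ltrDl divr_gt0.
have zs n : flow_dom (z, s n) by split => //; split => //=; rewrite tauz lte_fin.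
have scvg : s n @[n --> \oo] --> t.
  rewrite -[X in _ --> X]subr0; apply: cvgB; first exact: cvg_cst.
  by rewrite -(mulr0 t); apply: cvgM; [exact: cvg_cst|exact: cvg_harmonic].
pose F n : set R := `[0%R, s n]%classic.
have ndF : nondecreasing_seq F.
  move=> m n mn; apply/subsetPset => y; rewrite /F /= !in_itv/= => /andP[-> ym].
  rewrite (le_trans ym)//=.
  by rewrite lerB// ler_pM2l// lef_pV2 ?posrE// ler_nat.
have -> : \int[leb]_u (jump_density (z, u))%:E =
    \int[leb]_(u in \bigcup_n F n) (jump_density (z, u))%:E.
  rewrite [RHS]integral_mkcond; apply: eq_integral => u _.
  rewrite patchE; case: ifPn => // uF.
  rewrite jump_density_out// => -[/= _ [u0]]; rewrite tauz lte_fin => ut.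
  move/negP : uF; apply; rewrite inE.
  have [n _ sn] := scvg _ (lt_nbhsr ut).
  exists n => //; rewrite /F /= in_itv/= u0 ltW//.
  exact: sn (leqnn n).
have limF : \int[leb]_(u in F n) (jump_density (z, u))%:E @[n --> \oo] -->
    \int[leb]_(u in \bigcup_n F n) (jump_density (z, u))%:E.
  apply: ge0_nondecreasing_set_cvg_integral => //.
  - by move=> n; exact: measurable_itv.
  - by move=> n u _; rewrite lee_fin jump_density_ge0.
rewrite -(cvg_lim _ limF)//; apply: lime_le; first by apply/cvg_ex; eexists; exact: limF.
apply: nearW => n; rewrite integral_jump_density// lee_fin gerBl.
exact: survival_fun_ge0.
Qed.

(** The probability that the flow started at [z] reaches the boundary before
any jump: the atom of the sojourn at the hitting time. *)
Definition escape : T -> R :=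
  (fun z => 1 - fine (\int[leb]_u (jump_density (z, u))%:E))%R \_
  (E `&` [set z | clock z gamma < +oo]).

Lemma escapeE z v : E z -> tau z <= v%:E ->
  (escape z)%:E = 1 - \int[leb]_u (jump_density (z, u))%:E.
Proof.
move=> Ez zv; rewrite /escape patchE mem_set; last first.
  by split => //=; rewrite clock_boundary// (le_lt_trans zv)// ltry.
rewrite EFinB fineK// ge0_fin_numE.
  by rewrite (le_lt_trans (jump_density_mass Ez zv))// ltry.
by apply: integral_ge0 => u _; rewrite lee_fin jump_density_ge0.
Qed.

Lemma escape_eq0 z : E z -> +oo <= tau z -> escape z = 0%R.
Proof.
move=> Ez tauy; rewrite /escape patchE memNset// => -[_ /=].
by rewrite clock_boundary// ltNge tauy.
Qed.

Lemma escape_ge0 z : (0 <= escape z)%R.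
Proof.
rewrite /escape patchE; case: ifPn => // /set_mem[Ez /=].
rewrite clock_boundary// => tauy; rewrite subr_ge0 -lee_fin fineK.
  apply: (@jump_density_mass z (fine (tau z))) => //.
  by rewrite fineK// ge0_fin_numE ?hitting_time_ge0.
rewrite ge0_fin_numE; last first.
  by apply: integral_ge0 => u _; rewrite lee_fin jump_density_ge0.
rewrite (@le_lt_trans _ _ 1) ?ltry//.
apply: (@jump_density_mass z (fine (tau z))) => //.
by rewrite fineK// ge0_fin_numE ?hitting_time_ge0.
Qed.

Lemma measurable_escape : measurable_fun [set: T] escape.
Proof.
have mD : measurable (E `&` [set z : T | clock z gamma < +oo] : set T).
  apply: measurableI; first exact: measurable_state_space.
  rewrite -[X in measurable X]setTI; apply: measurable_lte => //.
  exact: measurable_clock.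
apply/(measurable_restrictT _ mD).
apply: measurable_funTS; apply: measurable_funB => //.
apply: measurableT_comp; first exact: fine_measurable.
apply: (@measurable_fun_fubini_tonelli_F _ _ T T R leb
  (fun p => (jump_density p)%:E)).
  by apply/measurable_EFinP; exact: measurable_jump_density.
by move=> p; rewrite lee_fin jump_density_ge0.
Qed.

(** The density along the flow and the atom at the hitting time have the
distribution function of the sojourn. *)
Lemma jump_density_ray z v : E z ->
  \int[leb]_(u in `]-oo, v]) (jump_density (z, u))%:E +
    (escape z * (tau z <= v%:E)%E%:R)%:E =
  if (v < 0)%R then 0 else 1 - survival gamma phi lambda z v.
Proof.
move=> Ez; have [vtau|tauv] := ltP v%:E (tau z); last first.
  rewrite ltNge -lee_fin (le_trans (hitting_time_ge0 z) tauv)/= mulr1.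
  rewrite /survival ltNge tauv/= sube0 (escapeE Ez tauv).
  have -> : \int[leb]_(u in `]-oo, v]) (jump_density (z, u))%:E =
      \int[leb]_u (jump_density (z, u))%:E.
    rewrite integral_mkcond; apply: eq_integral => u _.
    rewrite patchE; case: ifPn => // uv; rewrite jump_density_out//.
    move=> [/= _ [_ uz]]; move/negP : uv; apply; rewrite inE/= in_itv/=.
    by rewrite -lee_fin (le_trans (ltW uz)).
  rewrite addeC subeK// ge0_fin_numE; last first.
    by apply: integral_ge0 => u _; rewrite lee_fin jump_density_ge0.
  by rewrite (le_lt_trans (jump_density_mass Ez tauv))// ltry.
rewrite mulr0 adde0; have [v0|v0] := ltP v 0%R.
  rewrite integral0_eq// => u; rewrite /= in_itv/= => uv.
  rewrite jump_density_out// => -[/= _ [u0 _]].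
  by have := le_lt_trans (le_trans u0 uv) v0; rewrite ltxx.
have zv : flow_dom (z, v) by [].
rewrite survival_funE// -EFinB -integral_jump_density//.
rewrite [LHS]integral_mkcond [RHS]integral_mkcond; apply: eq_integral => u _.
rewrite !patchE !mem_setE !in_itv/=; case: (leP u v) => uv; last by rewrite andbF.
rewrite andbT; case: ifPn => // u0; rewrite jump_density_out//.
by move=> [/= _ [+ _]]; apply/negP.
Qed.

Lemma measurable_jump_density_ray v : measurable_fun [set: T]
  (fun z => \int[leb]_(u in `]-oo, v]) (jump_density (z, u))%:E).
Proof.
pose f (p : T * T) : \bar R := ((p.2 <= v)%R%:R * jump_density p)%:E.
rewrite (_ : (fun _ => _) = fun z => \int[leb]_u f (z, u)); last first.
  apply/funext => z; rewrite integral_mkcond; apply: eq_integral => u _.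
  rewrite patchE mem_setE in_itv/= /f.
  by case: (u <= v)%R; rewrite ?mul1r ?mul0r.
apply: (@measurable_fun_fubini_tonelli_F _ _ T T R leb f).
  rewrite /f; under eq_fun do rewrite EFinM.
  apply: emeasurable_funM.
    by apply: measurable_fun_bool_indic; exact: measurable_set_le.
  by apply/measurable_EFinP; exact: measurable_jump_density.
by move=> p; rewrite lee_fin mulr_ge0// jump_density_ge0.
Qed.

(** * The first jump after a given one *)

Section process.
Context d (Omega : measurableType d).
Variables (Z S : nat -> Omega -> R) (Q : subprobability Omega R).
Hypotheses
  (mZ : forall n, measurable_fun [set: Omega] (Z n))
  (mS : forall n, measurable_fun [set: Omega] (S n))
  (ZE : forall n o, E (Z n o))
  (S_gt0 : forall n o, (0 < S n o)%R)
  (S_le : forall n o, (S n o)%:E <= tau (Z n o)).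
Hypothesis sojourn : forall n H t, history Z S n.+1 n H -> (0 <= t)%R ->
  Q (H `&` [set o | (t < S n o)%R]) =
  \int[Q]_(o in H) survival gamma phi lambda (Z n o) t.

Definition jump_state (n : nat) (o : Omega) : T * T := (Z n o, jump_time S n o).

Lemma history_measurable_sum (G : set (set Omega)) n :
  (forall i, (i < n)%N ->
    measurable_fun [set: g_sigma_algebraType G] (S i : g_sigma_algebraType G -> R)) ->
  measurable_fun [set: g_sigma_algebraType G]
    (jump_time S n : g_sigma_algebraType G -> R).
Proof.
move=> mSG; elim: n => [|n IHn] in mSG *.
  rewrite (_ : jump_time S 0 = cst 0%R)//.
  by apply/funext => o; rewrite /jump_time big_ord0.
rewrite (_ : jump_time S n.+1 = jump_time S n \+ S n)%R; last first.
  by apply/funext => o; rewrite /jump_time big_ord_recr.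
apply: measurable_funD; last exact: mSG.
by apply: IHn => i i_n; apply: mSG; exact: leqW.
Qed.

Lemma history_jump_state n C : measurable C ->
  history Z S n.+1 n (jump_state n @^-1` C).
Proof.
move=> mC; rewrite /history; set G := [set B | _].
pose OG := g_sigma_algebraType G.
have mSG i : (i < n)%N -> measurable_fun [set: OG] (S i : OG -> R).
  move=> i_n _ A mA; rewrite setTI; apply: sub_sigma_algebra.
  by exists i, A; split => //; right.
have mZG : measurable_fun [set: OG] (Z n : OG -> R).
  move=> _ A mA; rewrite setTI; apply: sub_sigma_algebra.
  by exists n, A; split => //; left.
have : measurable_fun [set: OG] (jump_state n : OG -> T * T).
  apply: measurable_fun_pair => //; exact: history_measurable_sum.
by move=> /(_ measurableT _ mC); rewrite setTI.
Qed.

Lemma measurable_jump_time n : measurable_fun [set: Omega] (jump_time S n).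
Proof. by rewrite /jump_time; exact: measurable_sum. Qed.

Lemma measurable_jump_state n : measurable_fun [set: Omega] (jump_state n).
Proof. by apply: measurable_fun_pair; [exact: mZ|exact: measurable_jump_time]. Qed.

(** The conditional law of the sojourn is given on events of the past; as the
state after the last jump belongs to the past, it extends to its functions. *)
Lemma integral_sojourn_gt n t (q : T * T -> \bar R) : (0 <= t)%R ->
  measurable_fun [set: T * T] q -> (forall y, 0 <= q y) ->
  \int[Q]_o (q (jump_state n o) * (t < S n o)%R%:R%:E) =
  \int[Q]_o (q (jump_state n o) * (survival_fun (Z n o, t))%:E).
Proof.
move=> t0 mq q0.
have mtS : measurable [set o | (t < S n o)%R] by exact: measurable_set_lt.
have m1 : measurable_fun [set: Omega] (fun o => (t < S n o)%R%:R%:E : \bar R).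
  exact: measurable_fun_bool_indic.
have m2 : measurable_fun [set: Omega] (fun o => (survival_fun (Z n o, t))%:E).
  apply/measurable_EFinP; apply: measurableT_comp.
    exact: measurable_survival_fun.
  exact: measurable_fun_pair.
have p1 o : 0 <= (t < S n o)%R%:R%:E :> \bar R by rewrite lee_fin.
have p2 o : 0 <= (survival_fun (Z n o, t))%:E by rewrite lee_fin survival_fun_ge0.
have mY := measurable_jump_state n.
rewrite -(ge0_integral_weighted_image Q m1 p1 mY)//.
rewrite -(ge0_integral_weighted_image Q m2 p2 mY)//.
apply: eq_measure_integral => C mC _.
change (\int[Q]_(o in jump_state n @^-1` C) (t < S n o)%R%:R%:E =
  \int[Q]_(o in jump_state n @^-1` C) (survival_fun (Z n o, t))%:E).
rewrite integral_bool_indic//; last first.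
  by rewrite -[X in measurable X]setTI; exact: mY.
apply: (eq_trans (sojourn (@history_jump_state n C mC) t0)).
by apply: eq_integral => o _; rewrite survivalE.
Qed.

Lemma measurable_preimage_setT d1 d2 (T1 : measurableType d1)
    (T2 : measurableType d2) (f : T1 -> T2) (A : set T2) :
  measurable_fun [set: T1] f -> measurable A -> measurable (f @^-1` A).
Proof. by move=> mf mA; rewrite -[X in measurable X]setTI; exact: mf. Qed.

Lemma sojourn_le n (H : set Omega) v : measurable H ->
  history Z S n.+1 n H ->
  Q (H `&` [set o | (S n o <= v)%R]) =
  \int[Q]_(o in H) (if (v < 0)%R then 0 else 1 - (survival_fun (Z n o, v))%:E).
Proof.
move=> mH hH; have [v0|v0] := ltP v 0%R.
  rewrite integral0 (_ : _ `&` _ = set0) ?measure0//.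
  apply/seteqP; split => // o [_ /=]; rewrite leNgt.
  by rewrite (lt_trans v0).
have ms : measurable_fun [set: Omega] (fun o => survival_fun (Z n o, v)).
  apply: measurableT_comp; first exact: measurable_survival_fun.
  exact: measurable_fun_pair.
have mle : measurable [set o | (S n o <= v)%R] by exact: measurable_set_le.
have mlt : measurable [set o | (v < S n o)%R] by exact: measurable_set_lt.
have QHfin A : measurable A -> Q A \is a fin_num.
  move=> mA; rewrite ge0_fin_numE// (le_lt_trans _ (ltry 1%R))//.
  by rewrite (le_trans _ (sprobability_setT (s := Q)))// le_measure// inE.
have splitQ : Q (H `&` [set o | (v < S n o)%R]) + Q (H `&` [set o | (S n o <= v)%R]) = Q H.
  rewrite -measureU//; last 3 first.
  - exact: measurableI.
  - exact: measurableI.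
  - apply/seteqP; split => // o [[_ /= vS] [_ /= Sv]].
    by have := lt_le_trans vS Sv; rewrite ltxx.
  congr (Q _); rewrite -setIUr; apply/setIidPl => o _ /=.
  by case: (ltP v (S n o)); [left|right].
apply: (@adde_injl _ (Q (H `&` [set o | (v < S n o)%R]))).
  by apply: QHfin; exact: measurableI.
rewrite splitQ sojourn//.
under [X in _ = X + _]eq_integral do rewrite survivalE//.
have surv_le1 o : 0 <= 1 - (survival_fun (Z n o, v))%:E.
  rewrite sube_ge0// lee_fin /survival_fun patchE; case: ifPn => // _.
  rewrite -expR0 ler_expR oppr_le0 /cumulated_rate fine_ge0//.
  by apply: integral_ge0 => s _; rewrite lee_fin mulr_ge0// flow_rate_ge0.
rewrite -ge0_integralD//; last 3 first.
- by move=> o _; rewrite lee_fin survival_fun_ge0.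
- by apply/measurable_EFinP; exact: measurable_funTS.
- apply: emeasurable_funB => //.
  by apply/measurable_EFinP; exact: measurable_funTS.
under eq_integral do rewrite addeC subeK//.
by rewrite integral_cst// mul1e.
Qed.

(** Both sides are integrals with respect to finite measures, which agree on
the products of a set of states and a ray of times by the conditional law of
the sojourn. *)
Lemma integral_sojourn n (G : (T * T) * T -> \bar R) :
  measurable_fun [set: (T * T) * T] G -> (forall y, 0 <= G y) ->
  \int[Q]_o G (jump_state n o, S n o) =
  \int[Q]_o \int[leb]_u (G (jump_state n o, u) * (jump_density (Z n o, u))%:E) +
  \int[Q]_o (G (jump_state n o, fine (clock (Z n o) gamma)) * (escape (Z n o))%:E).
Proof.
move=> mG G0.
pose j (p : Omega * T) : (T * T) * T := (jump_state n p.1, p.2).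
pose h (p : Omega * T) : \bar R := (jump_density (Z n p.1, p.2))%:E.
pose b (o : Omega) : (T * T) * T := (jump_state n o, fine (clock (Z n o) gamma)).
pose e (o : Omega) : \bar R := (escape (Z n o))%:E.
have mj : measurable_fun [set: Omega * T] j.
  apply: measurable_fun_pair => //.
  exact: measurableT_comp (measurable_jump_state n) _.
have mZ1 : measurable_fun [set: Omega * T] (fun p => Z n p.1).
  exact: measurableT_comp.
have mh : measurable_fun [set: Omega * T] h.
  apply/measurable_EFinP; apply: measurableT_comp.
    exact: measurable_jump_density.
  exact: measurable_fun_pair.
have h0 p : 0 <= h p by rewrite lee_fin jump_density_ge0.
have mb : measurable_fun [set: Omega] b.
  apply: measurable_fun_pair; first exact: measurable_jump_state.
  apply: measurableT_comp; first exact: fine_measurable.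
  exact: measurableT_comp (measurable_clock gamma) (mZ n).
have me : measurable_fun [set: Omega] e.
  by apply/measurable_EFinP; exact: measurableT_comp measurable_escape (mZ n).
have e0 o : 0 <= e o by rewrite lee_fin escape_ge0.
have mk : measurable_fun [set: Omega] (fun o => (jump_state n o, S n o) : (T * T) * T).
  by apply: measurable_fun_pair; [exact: measurable_jump_state|exact: mS].
have m1 : measurable_fun [set: Omega] (cst (1 : \bar R)) by [].
pose N1 : {measure set ((T * T) * T) -> \bar R} :=
  weighted_image Q m1 (fun _ => lee01) mk.
pose N2 : {measure set ((T * T) * T) -> \bar R} :=
  measure_add (weighted_image (Q \x leb) mh h0 mj) (weighted_image Q me e0 mb).
transitivity (\int[N1]_y G y).
  rewrite ge0_integral_weighted_image//.
  by apply: eq_integral => o _; rewrite mule1.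
transitivity (\int[N2]_y G y); last first.
  rewrite ge0_integral_measure_add// !ge0_integral_weighted_image//.
  congr (_ + _); rewrite fubini_tonelli1//.
    apply: emeasurable_funM => //; exact: measurableT_comp.
  by move=> p; rewrite mule_ge0.
apply: eq_measure_integral => C mC _.
apply: (finite_measure_unique_raysX _ _ mC).
  rewrite (_ : N1 setT = Q setT).
    by rewrite (le_lt_trans sprobability_setT)// ltry.
  by rewrite /N1 /= /weighted_image preimage_setT integral_cst// mul1e.
move=> {C mC} A v mA.
pose H := jump_state n @^-1` A.
have mH : measurable H by apply: measurable_preimage_setT => //; exact: measurable_jump_state.
have ray_dens : weighted_image (Q \x leb) mh h0 mj (A `*` `]-oo, v]) =
    \int[Q]_(o in H) \int[leb]_(u in `]-oo, v]) (jump_density (Z n o, u))%:E.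
  rewrite /weighted_image integral_mkcond fubini_tonelli1; last 2 first.
  - have mD : measurable (j @^-1` (A `*` `]-oo, v]%classic)).
      by apply: measurable_preimage_setT => //; exact: measurableX.
    by apply/(measurable_restrictT _ mD); exact: measurable_funTS.
  - by move=> p; rewrite patchE; case: ifPn.
  rewrite [RHS]integral_mkcond; apply: eq_integral => o _.
  rewrite /fubini_F [RHS]patchE; case: ifPn => oH; last first.
    apply: integral0_eq => u _; rewrite patchE memNset// => -[/= Ao _].
    by move/negP : oH; apply; rewrite inE.
  rewrite [RHS]integral_mkcond; apply: eq_integral => u _; rewrite !patchE.
  have -> : ((o, u) \in j @^-1` (A `*` `]-oo, v])) = (u \in `]-oo, v]%classic).
    apply/idP/idP; rewrite !inE /j /=; first by case.
    by split => //; move/set_mem : oH.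
  by case: ifPn.
have ray_atom : weighted_image Q me e0 mb (A `*` `]-oo, v]) =
    \int[Q]_(o in H) (escape (Z n o) * (tau (Z n o) <= v%:E)%E%:R)%:E.
  rewrite /weighted_image [LHS]integral_mkcond [RHS]integral_mkcond.
  apply: eq_integral => o _; rewrite !patchE.
  have [tauy|tauy] := ltP (tau (Z n o)) +oo; last first.
    by rewrite /e escape_eq0// mul0r; do 2 case: ifPn => _.
  have tauE : (fine (clock (Z n o) gamma) <= v)%R = (tau (Z n o) <= v%:E).
    by rewrite clock_boundary// -lee_fin fineK// ge0_fin_numE// hitting_time_ge0.
  have -> : (o \in b @^-1` (A `*` `]-oo, v])) = (o \in H) && (tau (Z n o) <= v%:E).
    apply/idP/andP; rewrite !inE /b /= in_itv/= tauE; first by case.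
    by case.
  by case: ifPn => [/andP[-> ->]|]; rewrite ?mulr1//; case: ifPn => //= _ /negbTE ->; rewrite mulr0.
transitivity (Q (H `&` [set o | (S n o <= v)%R])).
  rewrite /N1 /= /weighted_image integral_cst//; last first.
    by apply: measurable_preimage_setT => //; exact: measurableX.
  by rewrite mul1e; congr (Q _); apply/seteqP; split => o /=; rewrite in_itv.
rewrite sojourn_le//; last exact: history_jump_state.
have -> : N2 (A `*` `]-oo, v]%classic) =
    weighted_image (Q \x leb) mh h0 mj (A `*` `]-oo, v]) +
    weighted_image Q me e0 mb (A `*` `]-oo, v]).
  exact: measure_addE.
rewrite ray_dens ray_atom -ge0_integralD//; last 4 first.
- by move=> o _; apply: integral_ge0 => u _; rewrite lee_fin jump_density_ge0.
- apply: measurable_funTS.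
  exact: measurableT_comp (measurable_jump_density_ray v) (mZ n).
- by move=> o _; rewrite lee_fin mulr_ge0// escape_ge0.
- apply: measurable_funTS; under eq_fun do rewrite EFinM.
  apply: emeasurable_funM => //.
  apply: (measurable_fun_bool_indic (b := fun o => tau (Z n o) <= v%:E)).
  rewrite (_ : [set _ | _] = setT `&` [set o | clock (Z n o) gamma <= v%:E]).
    apply: measurable_lee => //.
    exact: measurableT_comp (measurable_clock gamma) (mZ n).
  by rewrite setTI; apply/seteqP; split => o /=; rewrite clock_boundary.
apply: eq_integral => o _; rewrite jump_density_ray//.
by case: ltP => // v0; rewrite survivalE.
Qed.

(** Before the boundary is reached, the density of the sojourn is the intensity
times the probability that the sojourn is not over. *)
Lemma integral_unforced_jump n (G : (T * T) * T -> \bar R) :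
  measurable_fun [set: (T * T) * T] G -> (forall y, 0 <= G y) ->
  \int[Q]_o (G (jump_state n o, S n o) * (\1_flow_dom (Z n o, S n o))%:E) =
  \int[Q]_o \int[leb]_u (G (jump_state n o, u) *
    ((flow_rate (Z n o, u))%:E * (u < S n o)%R%:R%:E)).
Proof.
move=> mG G0.
have mpair : measurable_fun [set: (T * T) * T] (fun p => (p.1.1, p.2) : T * T).
  by apply: measurable_fun_pair => //; exact: measurableT_comp.
have mdom : measurable_fun [set: (T * T) * T] (fun p => (\1_flow_dom (p.1.1, p.2))%:E : \bar R).
  apply/measurable_EFinP; apply: measurableT_comp => //.
  by apply: measurable_indic; exact: measurable_flow_dom.
rewrite (@integral_sojourn n (fun p => G p * (\1_flow_dom (p.1.1, p.2))%:E)) /=; last 2 first.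
- exact: emeasurable_funM.
- by move=> p; rewrite mule_ge0// lee_fin.
rewrite [X in _ + X]integral0_eq ?adde0; last first.
  move=> o _; have [tauy|tauy] := ltP (tau (Z n o)) +oo; last first.
    by rewrite escape_eq0// mule0.
  rewrite indicE memNset ?mule0 ?mul0e// => -[/= _ [_]].
  by rewrite clock_boundary// fineK ?ltxx// ge0_fin_numE// hitting_time_ge0.
have mYu : measurable_fun [set: Omega * T] (fun p => (jump_state n p.1, p.2) : (T * T) * T).
  by apply: measurable_fun_pair => //; exact: measurableT_comp (measurable_jump_state n) _.
have mZ1 : measurable_fun [set: Omega * T] (fun p => Z n p.1).
  exact: measurableT_comp.
have mZu : measurable_fun [set: Omega * T] (fun p => (Z n p.1, p.2) : T * T).
  exact: measurable_fun_pair.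
have mGY := measurableT_comp mG mYu.
have mrate : measurable_fun [set: Omega * T] (fun p => (flow_rate (Z n p.1, p.2))%:E).
  by apply/measurable_EFinP; exact: measurableT_comp measurable_flow_rate mZu.
transitivity (\int[Q]_o \int[leb]_u (G (jump_state n o, u) *
    ((flow_rate (Z n o, u))%:E * (survival_fun (Z n o, u))%:E))).
  apply: eq_integral => o _; apply: eq_integral => u _.
  have [zu|zu] := pselect (flow_dom (Z n o, u)).
    by rewrite indicE mem_set// mule1 /jump_density EFinM.
  by rewrite jump_density_out// flow_rate_eq0// mul0e !mule0.
rewrite (fubini_tonelli (fun p => G (jump_state n p.1, p.2) *
    ((flow_rate (Z n p.1, p.2))%:E * (survival_fun (Z n p.1, p.2))%:E))); last 2 first.
- apply: emeasurable_funM => //; apply: emeasurable_funM => //.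
  by apply/measurable_EFinP; exact: measurableT_comp measurable_survival_fun mZu.
- move=> p; rewrite mule_ge0// mule_ge0// lee_fin ?flow_rate_ge0//.
  exact: survival_fun_ge0.
rewrite (fubini_tonelli (fun p => G (jump_state n p.1, p.2) *
    ((flow_rate (Z n p.1, p.2))%:E * (p.2 < S n p.1)%R%:R%:E))); last 2 first.
- apply: emeasurable_funM => //; apply: emeasurable_funM => //.
  apply: measurable_fun_bool_indic; apply: measurable_set_lt => //.
  exact: measurableT_comp.
- by move=> p; rewrite mule_ge0// mule_ge0// lee_fin ?flow_rate_ge0.
apply: eq_integral => u _.
have [u0|u0] := ltP u 0%R.
  have rate0 o : flow_rate (Z n o, u) = 0%R.
    by rewrite flow_rate_eq0// => -[/= _ []]; rewrite leNgt u0.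
  by apply: eq_integral => o _; rewrite rate0 !mul0e !mule0.
pose q (y : T * T) := G (y, u) * (flow_rate (y.1, u))%:E.
have mq : measurable_fun [set: T * T] q.
  apply: emeasurable_funM.
    by apply: measurableT_comp => //; exact: measurable_fun_pair.
  apply/measurable_EFinP; apply: measurableT_comp; first exact: measurable_flow_rate.
  exact: measurable_fun_pair.
have q0 y : 0 <= q y by rewrite mule_ge0// lee_fin flow_rate_ge0.
under eq_integral do rewrite /= muleA.
under [RHS]eq_integral do rewrite /= muleA.
by have := integral_sojourn_gt n u0 mq q0.
Qed.

(** * Occupation of the state space under the stationary law *)

Lemma jump_timeS n o : jump_time S n.+1 o = (jump_time S n o + S n o)%R.
Proof. by rewrite /jump_time big_ord_recr. Qed.

Lemma jump_time0 o : jump_time S 0 o = 0%R.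
Proof. by rewrite /jump_time big_ord0. Qed.

Lemma jump_time_ltS n o : (jump_time S n o < jump_time S n.+1 o)%R.
Proof. by rewrite jump_timeS ltrDl. Qed.

Lemma jump_time_le m n o : (m <= n)%N -> (jump_time S m o <= jump_time S n o)%R.
Proof.
have /nondecreasing_seqP : forall k, (jump_time S k o <= jump_time S k.+1 o)%R.
  by move=> k; exact/ltW/jump_time_ltS.
exact.
Qed.

Lemma jump_time_ge0 n o : (0 <= jump_time S n o)%R.
Proof. by rewrite -(jump_time0 o) jump_time_le. Qed.

Definition flow_point : T * T -> T := (fun p => phi p.1 p.2) \_ flow_dom.

Lemma flow_pointE z u : flow_dom (z, u) -> flow_point (z, u) = phi z u.
Proof. by move=> zu; rewrite /flow_point patchE mem_set. Qed.

Lemma measurable_flow_point : measurable_fun [set: T * T] flow_point.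
Proof.
apply/(measurable_restrictT _ measurable_flow_dom); exact: measurable_flow.
Qed.

Definition sojourn_event (n : nat) (s : R) : set Omega :=
  [set o | (jump_time S n o <= s < jump_time S n.+1 o)%R].

Lemma measurable_sojourn_event n s : measurable (sojourn_event n s).
Proof.
rewrite (_ : sojourn_event n s = [set o | (jump_time S n o <= s)%R] `&`
    [set o | (s < jump_time S n.+1 o)%R]).
  apply: measurableI.
    by apply: measurable_set_le => //; exact: measurable_jump_time.
  by apply: measurable_set_lt => //; exact: measurable_jump_time.
by apply/seteqP; split => o; [move/andP|move=> ?; exact/andP].
Qed.

Lemma sojourn_event_dom n s o : sojourn_event n s o ->
  flow_dom (Z n o, (s - jump_time S n o)%R).
Proof.
move=> /andP[Ts sT]; split; [exact: ZE|split => /=]; first by rewrite subr_ge0.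
rewrite (lt_le_trans _ (S_le n o))// lte_fin ltrBlDl.
by rewrite jump_timeS in sT.
Qed.

Lemma sojourn_event_inj m n s o :
  sojourn_event m s o -> sojourn_event n s o -> m = n.
Proof.
move=> /andP[ms sm] /andP[ns sn].
wlog mn : m n ms sm ns sn / (m < n)%N.
  move=> wl; have [mn|nm|//] := ltngtP m n; first exact: wl.
  by apply/esym; exact: wl.
have := lt_le_trans sm (jump_time_le o mn).
by rewrite ltNge ns.
Qed.

Lemma trivIset_sojourn_event s : trivIset setT (sojourn_event ^~ s).
Proof.
apply/trivIsetP => m n _ _ /eqP mn; apply/seteqP; split => // o [mo no].
by case: mn; exact: sojourn_event_inj mo no.
Qed.

Lemma pdmp_pathE n s o : sojourn_event n s o ->
  pdmp_path phi Z S s o = flow_point (Z n o, (s - jump_time S n o)%R).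
Proof.
move=> no; rewrite flow_pointE; last exact: sojourn_event_dom.
rewrite /pdmp_path; apply: xget_unique; first by exists n.
by move=> _ [m mo <-]; rewrite (sojourn_event_inj mo no).
Qed.

Definition explosion_event (s : R) : set Omega :=
  [set o | forall n, (jump_time S n o <= s)%R].

Lemma sojourn_event_cover s : (0 <= s)%R ->
  \bigcup_n sojourn_event n s = ~` explosion_event s.
Proof.
move=> s0; apply/seteqP; split => o.
  by move=> [n _ /andP[_ sn]] /(_ n.+1); rewrite leNgt sn.
move=> no; apply: contrapT => ncov; apply: no; elim => [|n IHn].
  by rewrite jump_time0.
rewrite leNgt; apply/negP => sn; apply: ncov; exists n => //.
by rewrite /sojourn_event /= IHn.
Qed.

Lemma pdmp_path_default s o : explosion_event s o -> pdmp_path phi Z S s o = Z 0%N o.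
Proof.
move=> eo; rewrite /pdmp_path; case: xgetP => // y _ [n /andP[_ sn] _].
by move: sn; rewrite ltNge eo.
Qed.

Lemma measurable_explosion_event s : measurable (explosion_event s).
Proof.
rewrite (_ : explosion_event s = \bigcap_n [set o | (jump_time S n o <= s)%R]).
  apply: bigcapT_measurable => n.
  by apply: measurable_set_le => //; exact: measurable_jump_time.
by apply/seteqP; split => x ex n; [move=> _; exact: ex|exact: (ex n Logic.I)].
Qed.

Let measurable_sojourn_point n s :
  measurable_fun [set: Omega] (fun o => flow_point (Z n o, (s - jump_time S n o)%R)).
Proof.
apply: measurableT_comp; first exact: measurable_flow_point.
apply: measurable_fun_pair => //; apply: measurable_funB => //.
exact: measurable_jump_time.
Qed.

Lemma measurable_pdmp_path s : (0 <= s)%R ->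
  measurable_fun [set: Omega] (pdmp_path phi Z S s : Omega -> T).
Proof.
move=> s0 _ A mA; rewrite setTI.
rewrite (_ : _ @^-1` _ = \bigcup_n (sojourn_event n s `&`
    (fun o => flow_point (Z n o, (s - jump_time S n o)%R)) @^-1` A) `|`
    (explosion_event s `&` Z 0%N @^-1` A)).
  apply: measurableU.
    apply: bigcupT_measurable => n; apply: measurableI.
      exact: measurable_sojourn_event.
    by apply: measurable_preimage_setT => //; exact: measurable_sojourn_point.
  apply: measurableI; first exact: measurable_explosion_event.
  exact: measurable_preimage_setT.
apply/seteqP; split => o /=.
  move=> oA; have [eo|] := pselect (explosion_event s o).
    by right; split => //; rewrite -(pdmp_path_default eo).
  rewrite -[~ _]/((~` _) o) -sojourn_event_cover// => -[n _ no].
  left; exists n => //; split=> //=.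
  by rewrite -(pdmp_pathE no).
move=> [[n _ [no /=]]|[eo]]; last by rewrite pdmp_path_default.
by rewrite (pdmp_pathE no).
Qed.

Section stationary.
Variable nu : probability T R.
Hypotheses
  (stationary_law : forall t A, (0 <= t)%R -> measurable A ->
     Q (pdmp_path phi Z S t @^-1` A) = nu A)
  (no_explosion : forall t, (0 <= t)%R -> Q (explosion_event t) = 0).

Lemma integral_pdmp_path (g : T -> \bar R) s : (0 <= s)%R ->
  measurable_fun [set: T] g -> (forall y, 0 <= g y) ->
  \int[Q]_o g (pdmp_path phi Z S s o) = \int[nu]_y g y.
Proof.
move=> s0 mg g0; have mX := measurable_pdmp_path s0.
have := @ge0_integral_pushforward _ _ _ _ _ _ mX Q setT g measurableT mg.
rewrite preimage_setT => <-//.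
by apply: eq_measure_integral => A mA _; exact: stationary_law.
Qed.

Lemma sum_integral_sojourn_event (g : T -> \bar R) s : (0 <= s)%R ->
  measurable_fun [set: T] g -> (forall y, 0 <= g y) ->
  \sum_(n <oo) \int[Q]_(o in sojourn_event n s)
    g (flow_point (Z n o, (s - jump_time S n o)%R)) = \int[nu]_y g y.
Proof.
move=> s0 mg g0; have mX := measurable_pdmp_path s0.
have mgX : measurable_fun [set: Omega] (g \o pdmp_path phi Z S s).
  exact: measurableT_comp.
rewrite -(integral_pdmp_path s0 mg g0).
rewrite -[in RHS](setUv (explosion_event s)) ge0_integral_setU//; last 4 first.
- exact: measurable_explosion_event.
- by apply: measurableC; exact: measurable_explosion_event.
- exact: measurable_funTS.
- by apply/disj_setPS => o [].
rewrite null_set_integral; last 3 first.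
- exact: measurable_explosion_event.
- exact: measurable_funTS.
- exact: no_explosion.
rewrite add0e.
rewrite -sojourn_event_cover// ge0_integral_bigcup//; last 3 first.
- by move=> n; exact: measurable_sojourn_event.
- exact: measurable_funTS.
- exact: trivIset_sojourn_event.
apply: eq_eseriesr => n _; apply: eq_integral => o /set_mem no.
by rewrite (pdmp_pathE no).
Qed.

(** The left side is the integral over the dates s in [0, t] of the expectation
of g at the position of the process at s, which does not depend on s. *)
Lemma integral_occupation (g : T -> \bar R) t : (0 <= t)%R ->
  measurable_fun [set: T] g -> (forall y, 0 <= g y) ->
  \sum_(n <oo) \int[Q]_o \int[leb]_u (g (flow_point (Z n o, u)) *
    ((0 <= u < S n o)%R && (jump_time S n o + u <= t)%R)%:R%:E) =
  t%:E * \int[nu]_y g y.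
Proof.
move=> t0 mg g0.
pose b n (p : Omega * T) := (0 <= p.2 <= t)%R &&
  (jump_time S n p.1 <= p.2 < jump_time S n.+1 p.1)%R.
pose h n (p : Omega * T) : \bar R :=
  g (flow_point (Z n p.1, (p.2 - jump_time S n p.1)%R)) * (b n p)%:R%:E.
have mJ n : measurable_fun [set: Omega * T] (fun p => jump_time S n p.1).
  apply: (measurableT_comp (measurable_jump_time n)).
  exact: measurable_fst.
have mZ1 n : measurable_fun [set: Omega * T] (fun p => Z n p.1).
  apply: (measurableT_comp (mZ n)); exact: measurable_fst.
have m2 : measurable_fun [set: Omega * T] (fun p => p.2 : R).
  exact: measurable_snd.
have mb n : measurable [set p | b n p].
  rewrite (_ : [set _ | _] = ([set p : Omega * T | (0 <= p.2)%R] `&`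
      [set p : Omega * T | (p.2 <= t)%R]) `&`
      ([set p : Omega * T | (jump_time S n p.1 <= p.2)%R] `&`
       [set p : Omega * T | (p.2 < jump_time S n.+1 p.1)%R])).
    apply: measurableI; apply: measurableI.
    - exact: measurable_set_le.
    - exact: measurable_set_le.
    - exact: measurable_set_le.
    - exact: measurable_set_lt.
  by apply/seteqP; split => p /=; rewrite /b; [case/andP => /andP[-> ->] /andP[]|
    case=> -[-> ->] [-> ->]].
have mh n : measurable_fun [set: Omega * T] (h n).
  apply: emeasurable_funM; last exact: measurable_fun_bool_indic.
  apply: (measurableT_comp mg); apply: (measurableT_comp measurable_flow_point).
  have mB : measurable_fun [set: Omega * T] (fun p => (p.2 - jump_time S n p.1)%R).
    exact: measurable_funB m2 (mJ n).
  exact: measurable_fun_pair (mZ1 n) mB.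
have h0 n p : 0 <= h n p by apply: mule_ge0; [exact: g0|rewrite lee_fin].
transitivity (\sum_(n <oo) \int[leb]_s \int[Q]_o h n (o, s)).
  apply: eq_eseriesr => n _.
  have hE : \int[Q]_o \int[leb]_s h n (o, s) = \int[leb]_s \int[Q]_o h n (o, s).
    exact: (fubini_tonelli (h n) (mh n) (h0 n)).
  rewrite -hE; apply: eq_integral => o _; rewrite -[RHS](ge0_integral_shift (jump_time S n o)).
  - apply: eq_integral => u _; rewrite /h /= addrC addrK; congr (_ * _%:R%:E).
    rewrite /b /= jump_timeS [(u + _)%R]addrC lerDl ltrD2l andbC.
    have [u0|_] := boolP (0 <= u)%R; last by rewrite !andbF.
    by rewrite [(0 <= _)%R]addr_ge0// jump_time_ge0.
  - exact: measurableT_comp (mh n) (measurable_pair1 o).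
  - by move=> s; exact: h0.
rewrite -integral_nneseries//; last 2 first.
- move=> n; exact: measurable_fun_fubini_tonelli_G.
- by move=> n s _; exact: integral_ge0.
transitivity (\int[leb]_(s in `[0%R, t]) (\int[nu]_y g y)); last first.
  rewrite integral_cst ?integral_ge0//= lebesgue_measure_itv/= lte_fin.
  case: ltgtP t0 => // [t0 _|<- _]; first by rewrite sube0 muleC.
  by rewrite mule0 mul0e.
rewrite [RHS]integral_mkcond; apply: eq_integral => s _.
rewrite patchE mem_setE in_itv/=; case: ifPn => [/andP[s0 st]|sN]; last first.
  apply: eseries0 => n _ _; apply: integral0_eq => o _.
  by rewrite /h /b /= (negbTE sN) mule0.
rewrite -(sum_integral_sojourn_event s0 mg g0).
apply: eq_eseriesr => n _; rewrite [RHS]integral_mkcond.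
apply: eq_integral => o _; rewrite patchE /h /b /= s0 st /=.
rewrite /sojourn_event mem_setb.
by case: ifPn => _; rewrite ?mule1 ?mule0.
Qed.

(** * The rate of the jumps, according to the state they leave *)

Variables (mu : R.-pker T ~> T) (sigma : R).
Hypotheses (nu_state_space : nu E = 1)
  (mu_state_space : forall x, E x \/ active_boundary gamma x -> mu x E = 1)
  (jump_law : forall n H A, history Z S n.+1 n.+1 H -> measurable A ->
     Q (H `&` Z n.+1 @^-1` A) = \int[Q]_(o in H) mu (phi (Z n o) (S n o)) A)
  (forced_rate : \sum_(n <oo) Q [set o | (jump_time S n.+1 o <= 1)%R /\
     active_boundary gamma (phi (Z n o) (S n o))] = sigma%:E)
  (intensity_nu : \int[nu]_(x in E) (lambda x)%:E < +oo).

(** The state from which the jump number n.+1 occurs. *)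
Definition landing (n : nat) (o : Omega) : T := phi (Z n o) (S n o).

Lemma landing_forced n o : ~ flow_dom (Z n o, S n o) -> (landing n o)%:E = gamma.
Proof.
move=> ndom; apply: flow_hitting_time => //; apply/eqP; rewrite eq_le S_le andbT.
rewrite leNgt; apply/negP => Stau; apply: ndom; split; first exact: ZE.
by split => //=; exact/ltW/S_gt0.
Qed.

Lemma landing_unforced n o : flow_dom (Z n o, S n o) -> E (landing n o).
Proof. by move=> [_ [S0 Stau]]; apply: (flow_in flow). Qed.

Lemma active_boundary_landing n o :
  active_boundary gamma (landing n o) <-> ~ flow_dom (Z n o, S n o).
Proof.
split; last exact: landing_forced.
rewrite /active_boundary /= => gE /landing_unforced /state_space_lt.
by rewrite gE ltxx.
Qed.

(** A form of [landing] from which its measurability can be read: [flow_point]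
is 0 off its domain. *)
Lemma landingE n o : landing n o = (flow_point (Z n o, S n o) +
  fine gamma * (1 - \1_flow_dom (Z n o, S n o)))%R.
Proof.
rewrite indicE; have [zs|zs] := pselect (flow_dom (Z n o, S n o)).
  by rewrite mem_set// subrr mulr0 addr0 flow_pointE.
by rewrite memNset// subr0 mulr1 /flow_point patchE memNset// add0r -(landing_forced zs).
Qed.

Lemma measurable_landing n : measurable_fun [set: Omega] (landing n).
Proof.
have mZS : measurable_fun [set: Omega] (fun o => (Z n o, S n o) : T * T).
  exact: measurable_fun_pair (mZ n) (mS n).
rewrite (_ : landing n = fun o => flow_point (Z n o, S n o) +
  fine gamma * (1 - \1_flow_dom (Z n o, S n o)))%R; last first.
  by apply/funext => o; rewrite landingE.
apply: measurable_funD.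
  exact: measurableT_comp measurable_flow_point mZS.
apply: measurable_funM => //; apply: measurable_funB => //.
apply: measurableT_comp mZS; apply: measurable_indic; exact: measurable_flow_dom.
Qed.

Definition intensity : R -> R := lambda \_ E.

Lemma intensity_ge0 x : (0 <= intensity x)%R.
Proof. by rewrite /intensity patchE; case: ifPn => // /set_mem /lambda_ge0. Qed.

Lemma measurable_intensity : measurable_fun [set: T] intensity.
Proof.
by apply/(measurable_restrictT _ measurable_state_space); exact: lambda_measurable.
Qed.

(** The forced jumps start from gamma and occur at rate sigma; the other ones
occur at rate lambda along the path, whose occupation up to time 1 is nu. If
gamma = +oo, the default value of [fine gamma] comes with sigma = 0. *)
Lemma sum_integral_landing (k : T -> \bar R) :
  measurable_fun [set: T] k -> (forall y, 0 <= k y) ->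
  k (fine gamma) \is a fin_num ->
  \sum_(n <oo) \int[Q]_o (k (landing n o) * (jump_time S n.+1 o <= 1)%R%:R%:E) =
  sigma%:E * k (fine gamma) + \int[nu]_y (k y * (intensity y)%:E).
Proof.
move=> mk k0 kg.
pose forced n := [set o | (jump_time S n.+1 o <= 1)%R /\
  active_boundary gamma (phi (Z n o) (S n o))].
have mT n : measurable [set o | (jump_time S n.+1 o <= 1)%R].
  by apply: measurable_set_le => //; exact: measurable_jump_time.
have mZS n : measurable_fun [set: Omega] (fun o => (Z n o, S n o) : T * T).
  exact: measurable_fun_pair (mZ n) (mS n).
have mdom n : measurable [set o | flow_dom (Z n o, S n o)].
  exact: measurable_preimage_setT (mZS n) measurable_flow_dom.
have forcedE n : forced n = [set o | (jump_time S n.+1 o <= 1)%R] `&`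
    ~` [set o | flow_dom (Z n o, S n o)].
  by apply/seteqP; split => o [T1 /active_boundary_landing gZ].
have mforced n : measurable (forced n).
  by rewrite forcedE; apply: measurableI => //; exact: measurableC.
pose G (p : (T * T) * T) : \bar R :=
  k (flow_point (p.1.1, p.2)) * (p.1.2 + p.2 <= 1)%R%:R%:E.
transitivity (\sum_(n <oo) (k (fine gamma) * Q (forced n) +
   \int[Q]_o \int[leb]_u (k (flow_point (Z n o, u)) * (intensity (flow_point (Z n o, u)))%:E *
     ((0 <= u < S n o)%R && (jump_time S n o + u <= 1)%R)%:R%:E))).
  apply: eq_eseriesr => n _.
  have mG : measurable_fun [set: (T * T) * T] G.
    apply: emeasurable_funM.
      apply: (measurableT_comp mk); apply: (measurableT_comp measurable_flow_point).
      by apply: measurable_fun_pair => //; exact: measurableT_comp.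
    apply: measurable_fun_bool_indic; apply: measurable_set_le => //.
    by apply: measurable_funD => //; exact: measurableT_comp.
  have G0 p : 0 <= G p by apply: mule_ge0; [exact: k0|rewrite lee_fin].
  have mS' : measurable_fun [set: Omega] (fun o => (jump_state n o, S n o) : (T * T) * T).
    exact: measurable_fun_pair (measurable_jump_state n) (mS n).
  transitivity (\int[Q]_o (k (fine gamma) * (\1_(forced n) o)%:E +
      G (jump_state n o, S n o) * (\1_flow_dom (Z n o, S n o))%:E)).
    apply: eq_integral => o _; rewrite forcedE !indicE in_setI mem_setb in_setC.
    rewrite /G /= jump_timeS.
    have [zs|zs] := pselect (flow_dom (Z n o, S n o)).
      rewrite (mem_set zs) (_ : (o \in _) = true); last exact/mem_set.
      by rewrite andbF mule0 add0e mule1 /landing flow_pointE.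
    rewrite (memNset zs) (_ : (o \in _) = false); last exact/memNset.
    by rewrite andbT mule0 adde0 -(landing_forced zs).
  rewrite ge0_integralD//; last 4 first.
  - by move=> o _; apply: mule_ge0; [exact: k0|rewrite lee_fin].
  - by apply: emeasurable_funM => //; apply/measurable_EFinP; exact: measurable_indic.
  - by move=> o _; apply: mule_ge0; [exact: G0|rewrite lee_fin].
  - apply: emeasurable_funM; first exact: measurableT_comp mG mS'.
    apply/measurable_EFinP; apply: measurableT_comp (mZS n).
    by apply: measurable_indic; exact: measurable_flow_dom.
  congr (_ + _).
    rewrite ge0_integralZl//; last by apply/measurable_EFinP; exact: measurable_indic.
    by rewrite integral_indic// setIT.
  rewrite (integral_unforced_jump n mG G0).
  apply: eq_integral => o _.
  apply: eq_integral => u _; rewrite /G /= -!muleA; congr (_ * _).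
  have [zu|zu] := pselect (flow_dom (Z n o, u)).
    have [_ [/= u0 utau]] := zu.
    rewrite flow_rateE// flow_pointE// /intensity patchE mem_set; last exact: (flow_in flow).
    rewrite muleCA; congr (_ * _); rewrite u0 /= -EFinM -natrM mulnb.
    by rewrite andbC.
  rewrite flow_rate_eq0// mul0e mule0 (_ : (0 <= u < S n o)%R = false) ?mule0//.
  apply/negP => /andP[u0 uS]; apply: zu; split; first exact: ZE.
  by split => //=; rewrite (lt_le_trans _ (S_le n o))// lte_fin.
rewrite nneseriesD//; last 2 first.
- by move=> n _ _; apply: mule_ge0.
- move=> n _ _; apply: integral_ge0 => o _; apply: integral_ge0 => u _.
  by rewrite !mule_ge0// lee_fin ?intensity_ge0.
congr (_ + _).
  by rewrite -(fineK kg) nneseriesZl// forced_rate muleC.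
rewrite -[RHS]mul1e -[RHS](@integral_occupation _ 1%R ler01)//.
- apply: emeasurable_funM => //; apply/measurable_EFinP; exact: measurable_intensity.
- by move=> y; rewrite mule_ge0// lee_fin intensity_ge0.
Qed.

(** * Balance of the crossings of a level *)

(** By stationarity, expected numbers of jumps up to time 1 are rates. *)
Definition takeoff_rate (x : R) : \bar R :=
  \sum_(n <oo) Q [set o | (jump_time S n.+1 o <= 1)%R && (x <= landing n o)%R].

Definition arrival_rate (x : R) : \bar R :=
  \sum_(n <oo) Q [set o | (jump_time S n.+1 o <= 1)%R && (x <= Z n.+1 o)%R].

Let measurable_jump_le n t : measurable [set o | (jump_time S n o <= t)%R].
Proof. by apply: measurable_set_le => //; exact: measurable_jump_time. Qed.

Lemma history_jump_time n (A : set R) : measurable A ->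
  history Z S n n (jump_time S n @^-1` A).
Proof.
move=> mA; rewrite /history; set G := [set B | _].
have mSG i : (i < n)%N -> measurable_fun [set: g_sigma_algebraType G]
    (S i : g_sigma_algebraType G -> R).
  move=> i_n _ B mB; rewrite setTI; apply: sub_sigma_algebra.
  by exists i, B; split => //; right.
by have := history_measurable_sum mSG measurableT mA; rewrite setTI.
Qed.

Lemma measurable_jump_above n x (X : Omega -> T) : measurable_fun [set: Omega] X ->
  measurable [set o | (jump_time S n.+1 o <= 1)%R && (x <= X o)%R].
Proof.
move=> mX; rewrite (_ : [set _ | _] =
    [set o | (jump_time S n.+1 o <= 1)%R] `&` [set o | (x <= X o)%R]).
  by apply: measurableI => //; exact: measurable_set_le.
by apply/seteqP; split => o; [move/andP|move=> ?; exact/andP].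
Qed.

Lemma measure_jump_above n x (X : Omega -> T) : measurable_fun [set: Omega] X ->
  Q [set o | (jump_time S n.+1 o <= 1)%R && (x <= X o)%R] =
  \int[Q]_o ((x <= X o)%R%:R%:E * (jump_time S n.+1 o <= 1)%R%:R%:E).
Proof.
move=> mX; set A := [set o | _].
rewrite -[A]setTI -integral_bool_indic//; last exact: measurable_jump_above.
by apply: eq_integral => o _; rewrite -EFinM -natrM mulnb andbC.
Qed.

Lemma takeoff_rateE x : takeoff_rate x =
  sigma%:E * (x <= fine gamma)%R%:R%:E +
  \int[nu]_y ((x <= y)%R%:R%:E * (intensity y)%:E).
Proof.
rewrite -(@sum_integral_landing (fun y => (x <= y)%R%:R%:E))//; last first.
  by apply: measurable_fun_bool_indic; exact: measurable_set_le.
apply: eq_eseriesr => n _.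
by rewrite (measure_jump_above _ _ (measurable_landing n)).
Qed.

Lemma arrival_rateE x : arrival_rate x =
  sigma%:E * mu (fine gamma) `[x, +oo[%classic +
  \int[nu]_y (mu y `[x, +oo[%classic * (intensity y)%:E).
Proof.
have mux : measurable (`[x, +oo[%classic : set T) by exact: measurable_itv.
rewrite -(@sum_integral_landing (fun y => mu y `[x, +oo[%classic))//; last 2 first.
- exact: measurable_kernel.
- rewrite ge0_fin_numE// (le_lt_trans _ (ltry 1%R))//.
  by rewrite -(prob_kernel (s := mu) (fine gamma)) le_measure// inE.
apply: eq_eseriesr => n _.
transitivity (Q ([set o | (jump_time S n.+1 o <= 1)%R] `&` Z n.+1 @^-1` `[x, +oo[%classic)).
  congr (Q _); apply/seteqP; split => o /=; rewrite in_itv/= andbT.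
    by move/andP.
  by move=> [-> ->].
rewrite jump_law//; last first.
  rewrite (_ : [set _ | _] = jump_time S n.+1 @^-1` `]-oo, 1%R]%classic).
    exact: history_jump_time.
  by apply/seteqP; split => o /=; rewrite in_itv.
rewrite integral_mkcond; apply: eq_integral => o _.
by rewrite patchE mem_setb; case: ifPn => _; rewrite ?mule1 ?mule0.
Qed.

Lemma pdmp_path0 : pdmp_path phi Z S 0 = Z 0%N.
Proof.
apply/funext => o; have o0 : sojourn_event 0 0 o.
  by rewrite /sojourn_event /= jump_time0 lexx jump_timeS jump_time0 add0r S_gt0.
rewrite (pdmp_pathE o0) flow_pointE ?jump_time0 ?subr0 ?(flow0 flow)//.
by have := sojourn_event_dom o0; rewrite jump_time0 subr0.
Qed.

(** The end of the part before time 1 of the path between two jumps, for [n]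
such that the jump number n has occurred; see [stopE]. *)
Definition stop (n : nat) (o : Omega) : T :=
  if (jump_time S n.+1 o <= 1)%R then landing n o
  else flow_point (Z n o, (1 - jump_time S n o)%R).

Lemma stopE n o : (jump_time S n o <= 1)%R ->
  stop n o = phi (Z n o) (Order.min (S n o) (1 - jump_time S n o))%R.
Proof.
move=> T1; rewrite /stop jump_timeS -lerBrDl; case: leP => [//|S1].
rewrite flow_pointE//; split; [exact: ZE|split] => /=; first by rewrite subr_ge0.
by rewrite (lt_le_trans _ (S_le n o))// lte_fin.
Qed.

Lemma measurable_stop n : measurable_fun [set: Omega] (stop n).
Proof.
apply: measurable_fun_ifT; last 2 first.
- exact: measurable_landing.
- exact: measurable_sojourn_point.
apply: (@measurable_fun_bool _ _ _ _ true).
by rewrite setTI; exact: measurable_jump_le.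
Qed.

(** Between two jumps [f] changes by the gain along the flow; over all the jumps
up to time 1 the values telescope, except for the values of [f] before the
jumps and after them, at time 0 and at time 1. The last two have the same
finite expectation, by stationarity. *)
Lemma jump_balance (f : T -> \bar R) (gain : nat -> Omega -> \bar R) :
  measurable_fun [set: T] f -> (forall y, 0 <= f y) -> \int[nu]_y f y < +oo ->
  (forall n, measurable_fun [set: Omega] (gain n)) ->
  (forall n o, 0 <= gain n o) ->
  (forall n o, (jump_time S n o <= 1)%R -> f (stop n o) = f (Z n o) + gain n o) ->
  (forall n o, (1 < jump_time S n o)%R -> gain n o = 0) ->
  \sum_(n <oo) \int[Q]_o (f (landing n o) * (jump_time S n.+1 o <= 1)%R%:R%:E) =
  \sum_(n <oo) \int[Q]_o (f (Z n.+1 o) * (jump_time S n.+1 o <= 1)%R%:R%:E) +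
  \sum_(n <oo) \int[Q]_o gain n o.
Proof.
move=> mf f0 fnu mgain gain0 stop_gain gain_out.
pose b n o : \bar R := (jump_time S n o <= 1)%R%:R%:E.
have mb n : measurable_fun [set: Omega] (b n).
  exact: measurable_fun_bool_indic (measurable_jump_le n 1%R).
have b0 n o : 0 <= b n o by rewrite lee_fin.
have mfX (X : Omega -> T) : measurable_fun [set: Omega] X ->
    measurable_fun [set: Omega] (fun o => f (X o)).
  by move=> mX; exact: measurableT_comp mf mX.
have fb0 n (X : Omega -> T) o : 0 <= f (X o) * b n o.
  by apply: mule_ge0; [exact: f0|exact: b0].
have mfb n (X : Omega -> T) : measurable_fun [set: Omega] X ->
    measurable_fun [set: Omega] (fun o => f (X o) * b n o).
  by move=> mX; exact: emeasurable_funM (mfX _ mX) (mb n).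
pose last_term n := \int[Q]_(o in sojourn_event n 1)
  f (flow_point (Z n o, (1 - jump_time S n o)%R)).
have balance n : \int[Q]_o (f (landing n o) * b n.+1 o) + last_term n =
    \int[Q]_o (f (Z n o) * b n o) + \int[Q]_o gain n o.
  rewrite -ge0_integralD//; last exact: (mfb n (Z n) (mZ n)).
  rewrite /last_term [X in _ + X = _]integral_mkcond -ge0_integralD//; last 3 first.
  - exact: (mfb n.+1 (landing n) (measurable_landing n)).
  - by move=> o _; rewrite patchE; case: ifPn.
  - apply/(measurable_restrictT _ (measurable_sojourn_event n 1)).
    by apply: measurable_funTS; apply: mfX; exact: measurable_sojourn_point.
  apply: eq_integral => o _; rewrite patchE /b mem_setb.
  have [T1|T1] := leP (jump_time S n o) 1%R; last first.
    by rewrite leNgt (lt_trans T1 (jump_time_ltS _ _))//= gain_out// !mule0.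
  rewrite mule1 -stop_gain// /stop leNgt.
  by case: ltP => _ /=; rewrite ?mule1 ?mule0 ?adde0 ?add0e.
have sum_balance :
    \sum_(n <oo) \int[Q]_o (f (landing n o) * b n.+1 o) + \int[nu]_y f y =
    \sum_(n <oo) \int[Q]_o (f (Z n o) * b n o) + \sum_(n <oo) \int[Q]_o gain n o.
  rewrite -(sum_integral_sojourn_event (ler01 : (0 <= 1 :> R)%R) mf f0).
  rewrite -nneseriesD; last 2 first.
  - by move=> n _ _; apply: integral_ge0 => o _; exact: fb0.
  - by move=> n _ _; apply: integral_ge0.
  rewrite -[RHS]nneseriesD; last 2 first.
  - by move=> n _ _; apply: integral_ge0 => o _; exact: fb0.
  - by move=> n _ _; apply: integral_ge0.
  by apply: eq_eseriesr => n _; exact: balance.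
have initial : \int[Q]_o (f (Z 0%N o) * b 0%N o) = \int[nu]_y f y.
  rewrite -(integral_pdmp_path (lexx 0%R) mf f0) pdmp_path0.
  by apply: eq_integral => o _; rewrite /b jump_time0 ler01 mule1.
apply: (@adde_injl _ (\int[nu]_y f y)).
  by rewrite ge0_fin_numE//; exact: integral_ge0.
rewrite addeC sum_balance nneseries_recl//; last first.
  by move=> n _; apply: integral_ge0 => o _; exact: fb0.
rewrite initial -addeA -nneseries_addn; last first.
  by move=> n; apply: integral_ge0 => o _; exact: fb0.
by under eq_eseriesr do rewrite addn1.
Qed.

(** The indicator of the states above x cannot decrease along the flow, so its
gains in [jump_balance] are nonnegative. *)
Lemma arrival_le_takeoff x : arrival_rate x <= takeoff_rate x.
Proof.
pose f (y : T) : \bar R := (x <= y)%R%:R%:E.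
have mf : measurable_fun [set: T] f.
  by apply: measurable_fun_bool_indic; exact: measurable_set_le.
have f0 y : 0 <= f y by rewrite lee_fin.
pose gained n o := [&& (jump_time S n o <= 1)%R, (x <= stop n o)%R & (Z n o < x)%R].
pose gain n o : \bar R := (gained n o)%:R%:E.
have gain0 n o : 0 <= gain n o by rewrite lee_fin.
have fnu : \int[nu]_y f y < +oo.
  rewrite integral_bool_indic//; last exact: measurable_set_le.
  by rewrite (le_lt_trans (probability_le1 _ _))// ?ltry// setTI; exact: measurable_set_le.
have mgain n : measurable_fun [set: Omega] (gain n).
  apply: measurable_fun_bool_indic.
  rewrite (_ : [set _ | _] = [set o | (jump_time S n o <= 1)%R] `&`
      ([set o | (x <= stop n o)%R] `&` [set o | (Z n o < x)%R])).
    apply: measurableI; first exact: measurable_jump_le.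
    apply: measurableI; first by apply: measurable_set_le => //; exact: measurable_stop.
    exact: measurable_set_lt (mZ n) _.
  by apply/seteqP; split => o; [case/and3P|move=> -[? [? ?]]; exact/and3P].
have stop_gain n o : (jump_time S n o <= 1)%R -> f (stop n o) = f (Z n o) + gain n o.
  move=> T1; rewrite /gain /gained T1 /f -EFinD -natrD; congr (_%:R%:E).
  have Zstop : (Z n o <= stop n o)%R.
    rewrite stopE//; apply: flow_ge; first exact: ZE.
      by rewrite le_min ltW//= subr_ge0.
    by rewrite (le_trans _ (S_le n o))// lee_fin ge_min lexx.
  by have [xZ|Zx] := leP x (Z n o); rewrite ?(le_trans xZ Zstop) ?andbF ?andbT.
have gain_out n o : (1 < jump_time S n o)%R -> gain n o = 0.
  by rewrite /gain /gained ltNge => /negbTE ->.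
have takeoffE : takeoff_rate x =
    \sum_(n <oo) \int[Q]_o (f (landing n o) * (jump_time S n.+1 o <= 1)%R%:R%:E).
  by apply: eq_eseriesr => n _; exact: measure_jump_above (measurable_landing n).
have arrivalE : arrival_rate x =
    \sum_(n <oo) \int[Q]_o (f (Z n.+1 o) * (jump_time S n.+1 o <= 1)%R%:R%:E).
  by apply: eq_eseriesr => n _; exact: measure_jump_above (mZ n.+1).
rewrite takeoffE arrivalE (jump_balance mf f0 fnu mgain gain0 stop_gain gain_out).
rewrite leeDl//; apply: nneseries_ge0 => n _ _.
by apply: integral_ge0.
Qed.

Lemma measurable_jump_above_pair n (X : Omega -> T) : measurable_fun [set: Omega] X ->
  measurable [set p : Omega * T | (jump_time S n.+1 p.1 <= 1)%R && (p.2 <= X p.1)%R].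
Proof.
move=> mX; rewrite (_ : [set _ | _] =
    [set p : Omega * T | (jump_time S n.+1 p.1 <= 1)%R] `&`
    [set p : Omega * T | (p.2 <= X p.1)%R]).
  apply: measurableI; apply: measurable_set_le => //.
    apply: (measurableT_comp (measurable_jump_time n.+1)); exact: measurable_fst.
  apply: (measurableT_comp mX); exact: measurable_fst.
by apply/seteqP; split => p /=; [case/andP|move=> [-> ->]].
Qed.

Lemma measurable_jump_above_rate n (X : Omega -> T) : measurable_fun [set: Omega] X ->
  measurable_fun [set: T]
    (fun x => Q [set o | (jump_time S n.+1 o <= 1)%R && (x <= X o)%R]).
Proof.
move=> mX; pose h (p : Omega * T) : \bar R :=
  ((jump_time S n.+1 p.1 <= 1)%R && (p.2 <= X p.1)%R)%:R%:E.
rewrite (_ : (fun _ => _) = fun x => \int[Q]_o h (o, x)); last first.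
  apply/funext => x; rewrite integral_bool_indic ?setTI//.
  exact: measurable_jump_above.
apply: (measurable_fun_fubini_tonelli_G h).
  by apply: measurable_fun_bool_indic; exact: measurable_jump_above_pair.
by move=> p; rewrite lee_fin.
Qed.

Lemma measurable_takeoff_rate : measurable_fun [set: T] takeoff_rate.
Proof.
apply: ge0_emeasurable_sum => // n _.
exact: measurable_jump_above_rate (measurable_landing n).
Qed.

Lemma measurable_arrival_rate : measurable_fun [set: T] arrival_rate.
Proof.
by apply: ge0_emeasurable_sum => // n _; exact: measurable_jump_above_rate (mZ n.+1).
Qed.

(** Tonelli, for the integral over the levels that defines [rise]. *)
Lemma integral_rise n a b (X : Omega -> T) : measurable_fun [set: Omega] X ->
  \int[Q]_o (rise a b (X o) * (jump_time S n.+1 o <= 1)%R%:R%:E) =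
  \int[leb]_(x in `[a, b[) ((slowness x)%:E *
    Q [set o | (jump_time S n.+1 o <= 1)%R && (x <= X o)%R]).
Proof.
move=> mX.
pose h (p : Omega * T) : \bar R :=
  (a <= p.2 < b)%R%:R%:E * ((slowness p.2)%:E *
   ((jump_time S n.+1 p.1 <= 1)%R && (p.2 <= X p.1)%R)%:R%:E).
have h0 p : 0 <= h p by rewrite !mule_ge0 ?lee_fin ?slowness_ge0.
have mh : measurable_fun [set: Omega * T] h.
  apply: emeasurable_funM.
    apply: measurable_fun_bool_indic.
    rewrite (_ : [set _ | _] = [set p : Omega * T | (a <= p.2)%R] `&`
      [set p : Omega * T | (p.2 < b)%R]).
      apply: measurableI; first by apply: measurable_set_le => //; exact: measurable_snd.
      by apply: measurable_set_lt => //; exact: measurable_snd.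
    by apply/seteqP; split => p /=; [case/andP|move=> [-> ->]].
  apply: emeasurable_funM.
    apply/measurable_EFinP; apply: measurableT_comp; first exact: measurable_slowness.
    exact: measurable_snd.
  by apply: measurable_fun_bool_indic; exact: measurable_jump_above_pair.
have hE : \int[Q]_o \int[leb]_x h (o, x) = \int[leb]_x \int[Q]_o h (o, x).
  exact: (fubini_tonelli h mh h0).
transitivity (\int[Q]_o \int[leb]_x h (o, x)).
  apply: eq_integral => o _.
  rewrite muleC /rise -ge0_integralZl//; last 2 first.
  - apply/measurable_EFinP; apply: measurable_funM; last exact: measurable_funTS measurable_slowness.
    apply/measurable_EFinP; apply: measurable_funTS.
    by apply: measurable_fun_bool_indic; exact: measurable_set_le.
  - by move=> x _; rewrite lee_fin mulr_ge0// slowness_ge0.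
  rewrite integral_mkcond; apply: eq_integral => x _.
  rewrite patchE mem_setE in_itv/= /h /=; case: ifPn => xab; last by rewrite mul0e.
  rewrite mul1e -!EFinM; congr EFin.
  by case: (jump_time S n.+1 o <= 1)%R; case: (x <= X o)%R; rewrite /= ?(mul1r,mul0r,mulr0,mulr1).
rewrite hE [RHS]integral_mkcond; apply: eq_integral => x _.
rewrite patchE mem_setE in_itv/=; case: ifPn => xab; last first.
  by apply: integral0_eq => o _; rewrite /h /= (negbTE xab) mul0e.
under eq_integral => o _ do rewrite /h /= xab mul1e.
rewrite ge0_integralZl//; last 2 first.
- by apply: measurable_fun_bool_indic; exact: measurable_jump_above.
- by rewrite lee_fin slowness_ge0.
by rewrite integral_bool_indic// ?setTI//; exact: measurable_jump_above.
Qed.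

Lemma clock_lty a b : I a -> I b -> clock a b%:E < +oo.
Proof.
move=> Ia Ib; rewrite clockE.
have ab_I : `[a, b]%classic `<=` I.
  move=> x /=; rewrite in_itv/= => /andP[ax xb]; apply/andP; split.
    by have /andP[wa _] := Ia; rewrite (lt_le_trans wa)// lee_fin.
  by have /andP[_ bg] := Ib; rewrite (le_lt_trans _ bg)// lee_fin.
have intr : lebesgue_measure.-integrable `[a, b]%classic (EFin \o (fun x => (r x)^-1)%R).
  apply: continuous_compact_integrable; first exact: segment_compact.
  apply: continuous_in_subspaceT => x /set_mem /ab_I.
  exact: velocity_inv_continuous.
rewrite integral_itv_bndo_bndc; last exact: measurable_slownessE.
have -> : \int[leb]_(x in `[a, b]) (slowness x)%:E =
    \int[leb]_(x in `[a, b]) (EFin \o (fun x => (r x)^-1)%R) x.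
  by apply: eq_integral => x /set_mem /ab_I Ix; rewrite /= slownessE.
exact: integrable_lty.
Qed.

Lemma rise_le a b y : I a -> I b -> (a <= b)%R -> rise a b y <= clock a b%:E.
Proof.
by move=> Ia Ib ab; rewrite rise_clock//; apply: clock_le; rewrite lee_fin ge_min lexx.
Qed.

Lemma measurable_rise a b : (a <= b)%R -> measurable_fun [set: T] (rise a b).
Proof.
move=> ab; rewrite (_ : rise a b = fun y => \int[leb]_x (
    (a <= x < b)%R%:R * ((x <= y)%R%:R * slowness x))%:E); last first.
  apply/funext => y; rewrite /rise integral_mkcond; apply: eq_integral => x _.
  by rewrite patchE mem_setE in_itv/=; case: ifPn => _; rewrite ?mul1r ?mul0r.
pose h (p : T * T) : \bar R :=
  ((a <= p.2 < b)%R%:R * ((p.2 <= p.1)%R%:R * slowness p.2))%:E.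
apply: (@measurable_fun_fubini_tonelli_F _ _ T T R leb h).
  apply/measurable_EFinP; apply: measurable_funM.
    apply/measurable_EFinP; apply: measurable_fun_bool_indic.
    rewrite (_ : [set _ | _] = [set p : T * T | (a <= p.2)%R] `&`
      [set p : T * T | (p.2 < b)%R]).
      apply: measurableI; first by apply: measurable_set_le => //; exact: measurable_snd.
      by apply: measurable_set_lt => //; exact: measurable_snd.
    by apply/seteqP; split => p /=; [case/andP|move=> [-> ->]].
  apply: measurable_funM; last first.
    by apply: measurableT_comp; [exact: measurable_slowness|exact: measurable_snd].
  apply/measurable_EFinP; apply: measurable_fun_bool_indic.
  apply: measurable_set_le; first exact: measurable_snd.
  exact: measurable_fst.
by move=> p; rewrite lee_fin !mulr_ge0// slowness_ge0.
Qed.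

Lemma rise_stop a b n o : (a <= b)%R -> (jump_time S n o <= 1)%R ->
  rise a b (stop n o) = rise a b (Z n o) +
    \int[leb]_u ((a <= flow_point (Z n o, u) < b)%R%:R%:E *
      ((0 <= u < S n o)%R && (jump_time S n o + u <= 1)%R)%:R%:E).
Proof.
move=> ab T1; rewrite stopE//; set v := Order.min _ _.
have v0 : (0 <= v)%R by rewrite le_min ltW//= subr_ge0.
have vtau : v%:E <= tau (Z n o).
  by rewrite (le_trans _ (S_le n o))// lee_fin ge_min lexx.
rewrite (rise_occupation (ZE n o) v0 vtau ab); congr (_ + _).
have mfp : measurable_fun [set: T] (fun u => flow_point (Z n o, u)).
  apply: measurableT_comp; first exact: measurable_flow_point.
  exact: measurable_pair1.
have mab : measurable [set u : T | (a <= flow_point (Z n o, u) < b)%R].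
  rewrite (_ : [set _ | _] = [set u : T | (a <= flow_point (Z n o, u))%R] `&`
      [set u : T | (flow_point (Z n o, u) < b)%R]).
    by apply: measurableI; [exact: measurable_set_le|exact: measurable_set_lt].
  by apply/seteqP; split => u /=; [case/andP|move=> [-> ->]].
transitivity (\int[leb]_(u in `[0%R, v[) (a <= flow_point (Z n o, u) < b)%R%:R%:E).
  rewrite integral_bool_indic//; congr (leb _); apply/seteqP; split => u /=.
    move=> [/andP[u0 uv]]; rewrite in_itv/= u0 uv flow_pointE//.
    by split; [exact: ZE|split => //=; rewrite (lt_le_trans _ vtau)// lte_fin].
  rewrite in_itv/= => -[/andP[u0 uv]]; rewrite u0 uv flow_pointE//.
  by split; [exact: ZE|split => //=; rewrite (lt_le_trans _ vtau)// lte_fin].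
have patch_itv (c : R -> bool) (J : interval R) : (forall u, (u \in J) = c u) ->
    \int[leb]_(u in [set` J]) (a <= flow_point (Z n o, u) < b)%R%:R%:E =
    \int[leb]_u ((a <= flow_point (Z n o, u) < b)%R%:R%:E * (c u)%:R%:E).
  move=> cJ; rewrite integral_mkcond; apply: eq_integral => u _.
  by rewrite patchE mem_setE cJ; case: ifPn => _; rewrite ?mule1 ?mule0.
have [S1|S1] := leP (S n o) (1 - jump_time S n o)%R.
  apply: patch_itv => u; rewrite in_itv/= /v (min_l S1).
  have [/andP[u0 uS]|//] := boolP (0 <= u < S n o)%R.
  by rewrite -lerBrDl (le_trans (ltW uS)).
(* the dates [0, v) and [0, v] have the same occupation *)
rewrite integral_itv_bndo_bndc; last first.
  by apply: measurable_funTS; exact: measurable_fun_bool_indic.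
apply: patch_itv => u; rewrite in_itv/= /v (min_r (ltW S1)) -lerBrDl.
have [u1|] := leP u; last by rewrite !andbF.
by rewrite (le_lt_trans u1 S1) !andbT.
Qed.

(** This is [jump_balance] for [rise a b], whose gains are the times spent in
[a, b). *)
Lemma slowness_balance a b : I a -> I b -> (a <= b)%R ->
  \int[leb]_(x in `[a, b[) ((slowness x)%:E * takeoff_rate x) =
  \int[leb]_(x in `[a, b[) ((slowness x)%:E * arrival_rate x) +
  nu `[a, b[%classic.
Proof.
move=> Ia Ib ab; have mf := measurable_rise ab; have f0 y := rise_ge0 a b y.
have fnu : \int[nu]_y rise a b y < +oo.
  rewrite (@le_lt_trans _ _ (\int[nu]_y (cst (clock a b%:E) y)))//.
    by apply: ge0_le_integral => // y _; exact: rise_le.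
  rewrite integral_cst// lte_mul_pinfty ?clock_ge0//.
    by rewrite ge0_fin_numE ?clock_ge0// clock_lty.
  by rewrite (le_lt_trans (probability_le1 _ _))// ltry.
have mab : measurable [set y : T | (a <= y < b)%R].
  rewrite (_ : [set _ | _] = `[a, b[%classic); first exact: measurable_itv.
  by apply/seteqP; split => u /=; rewrite in_itv.
pose g (y : T) : \bar R := (a <= y < b)%R%:R%:E.
have mg : measurable_fun [set: T] g.
  exact: measurable_fun_bool_indic.
have g0 y : 0 <= g y by rewrite lee_fin.
pose inside n (p : Omega * T) :=
  (0 <= p.2 < S n p.1)%R && (jump_time S n p.1 + p.2 <= 1)%R.
pose h n (p : Omega * T) : \bar R := g (flow_point (Z n p.1, p.2)) * (inside n p)%:R%:E.
pose gain n o := \int[leb]_u h n (o, u).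
have h0 n p : 0 <= h n p by rewrite mule_ge0// lee_fin.
have gain0 n o : 0 <= gain n o by apply: integral_ge0 => u _; exact: h0.
have mh n : measurable_fun [set: Omega * T] (h n).
  apply: emeasurable_funM.
    apply: (measurableT_comp mg); apply: (measurableT_comp measurable_flow_point).
    apply: measurable_fun_pair; last exact: measurable_snd.
    apply: (measurableT_comp (mZ n)); exact: measurable_fst.
  apply: measurable_fun_bool_indic.
  rewrite (_ : [set _ | _] = ([set p : Omega * T | (0 <= p.2)%R] `&`
    [set p : Omega * T | (p.2 < S n p.1)%R]) `&`
    [set p : Omega * T | (jump_time S n p.1 + p.2 <= 1)%R]).
    have m2 : measurable_fun [set: Omega * T] (fun p => p.2 : R).
      exact: measurable_snd.
    apply: measurableI; first (apply: measurableI; first exact: measurable_set_le).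
      apply: measurable_set_lt m2 _.
      apply: (measurableT_comp (mS n)); exact: measurable_fst.
    apply: measurable_set_le => //; apply: measurable_funD m2.
    apply: (measurableT_comp (measurable_jump_time n)); exact: measurable_fst.
  by apply/seteqP; split => p /=; [case/andP => /andP[]|move=> [[]]]; rewrite /inside => -> -> ->.
have mgain n : measurable_fun [set: Omega] (gain n).
  exact: measurable_fun_fubini_tonelli_F (mh n) (h0 n).
have stop_gain n o : (jump_time S n o <= 1)%R ->
    rise a b (stop n o) = rise a b (Z n o) + gain n o.
  by move=> T1; exact: rise_stop.
have gain_out n o : (1 < jump_time S n o)%R -> gain n o = 0.
  move=> T1; apply: integral0_eq => u _.
  rewrite /h (_ : inside n (o, u) = false) ?mule0//.
  apply/negP => /andP[/andP[u0 _]] /=; apply/negP; rewrite -ltNge.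
  by rewrite (lt_le_trans T1)// lerDl.
have sum_rise (X : nat -> Omega -> T) : (forall n, measurable_fun [set: Omega] (X n)) ->
    \sum_(n <oo) \int[Q]_o (rise a b (X n o) * (jump_time S n.+1 o <= 1)%R%:R%:E) =
    \int[leb]_(x in `[a, b[) ((slowness x)%:E *
      \sum_(n <oo) Q [set o | (jump_time S n.+1 o <= 1)%R && (x <= X n o)%R]).
  move=> mX.
  under eq_eseriesr => n _ do rewrite (integral_rise n a b (mX n)).
  rewrite -integral_nneseries//; last 2 first.
  - move=> n; apply: emeasurable_funM.
      exact: measurable_slownessE.
    by apply: measurable_funTS; exact: measurable_jump_above_rate.
  - by move=> n x _; rewrite mule_ge0// lee_fin slowness_ge0.
  by apply: eq_integral => x _; rewrite nneseriesZl.
apply: (eq_trans (esym (sum_rise landing measurable_landing))).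
apply: (eq_trans (jump_balance mf f0 fnu mgain gain0 stop_gain gain_out)).
congr (_ + _); first exact: sum_rise (fun n => mZ n.+1).
have := @integral_occupation g 1%R ler01 mg g0.
rewrite mul1e => occ; rewrite /gain /h /inside /= occ integral_bool_indic//.
by rewrite setTI; congr (nu _); apply/seteqP; split => u /=; rewrite in_itv.
Qed.

(** * The stationary density *)

Lemma boundary_rate_ge0 : (0 <= sigma)%R.
Proof. by rewrite -lee_fin -forced_rate; exact: nneseries_ge0. Qed.

Lemma intensity_lty : \int[nu]_y (intensity y)%:E < +oo.
Proof.
suff -> : \int[nu]_y (intensity y)%:E = \int[nu]_(y in E) (lambda y)%:E by [].
rewrite [RHS]integral_mkcond; apply: eq_integral => y _.
by rewrite /intensity !patchE; case: ifPn.
Qed.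

Definition total_rate : R := (sigma + fine (\int[nu]_y (intensity y)%:E))%R.

Lemma takeoff_rate_le x : takeoff_rate x <= total_rate%:E.
Proof.
rewrite takeoff_rateE EFinD fineK; last first.
  rewrite ge0_fin_numE ?intensity_lty//.
  by apply: integral_ge0 => y _; rewrite lee_fin intensity_ge0.
apply: leeD.
  by rewrite -EFinM lee_fin ler_piMr ?boundary_rate_ge0// lern1 leq_b1.
apply: ge0_le_integral => //.
- by move=> y _; rewrite mule_ge0// lee_fin intensity_ge0.
- apply: emeasurable_funM.
    by apply: measurable_fun_bool_indic; exact: measurable_set_le.
  by apply/measurable_EFinP; exact: measurable_intensity.
- by apply/measurable_EFinP; exact: measurable_intensity.
- move=> y _; rewrite -EFinM lee_fin ler_piMl ?intensity_ge0//.
  by rewrite lern1 leq_b1.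
Qed.

Lemma takeoff_rate_ge0 x : 0 <= takeoff_rate x.
Proof. exact: nneseries_ge0. Qed.

Lemma arrival_rate_ge0 x : 0 <= arrival_rate x.
Proof. exact: nneseries_ge0. Qed.

Lemma takeoff_rate_fin x : takeoff_rate x \is a fin_num.
Proof.
by rewrite ge0_fin_numE ?takeoff_rate_ge0// (le_lt_trans (takeoff_rate_le x))// ltry.
Qed.

Lemma arrival_rate_fin x : arrival_rate x \is a fin_num.
Proof.
rewrite ge0_fin_numE ?arrival_rate_ge0// (le_lt_trans (arrival_le_takeoff x))//.
by rewrite -ge0_fin_numE ?takeoff_rate_ge0// takeoff_rate_fin.
Qed.

(** The net rate at which the jumps bring the process from above x to below it,
and hence, in the stationary regime, the rate at which the flow crosses x. *)
Definition flux (x : R) : R := (fine (takeoff_rate x) - fine (arrival_rate x))%R.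

Lemma flux_ge0 x : (0 <= flux x)%R.
Proof.
rewrite subr_ge0 fine_le ?arrival_rate_fin ?takeoff_rate_fin//.
exact: arrival_le_takeoff.
Qed.

Lemma takeoff_flux x : takeoff_rate x = arrival_rate x + (flux x)%:E.
Proof.
by rewrite -(fineK (takeoff_rate_fin x)) -(fineK (arrival_rate_fin x)) -EFinD addrC subrK.
Qed.

Lemma measurable_flux : measurable_fun [set: T] flux.
Proof.
apply: measurable_funB; (apply: measurableT_comp; first exact: fine_measurable).
  exact: measurable_takeoff_rate.
exact: measurable_arrival_rate.
Qed.

Definition density (x : R) : R := (slowness x * flux x)%R.

Lemma density_ge0 x : (0 <= density x)%R.
Proof. by rewrite mulr_ge0 ?slowness_ge0 ?flux_ge0. Qed.

Lemma measurable_density : measurable_fun [set: T] density.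
Proof.
by apply: measurable_funM; [exact: measurable_slowness|exact: measurable_flux].
Qed.

Lemma density_eq0 x : ~ I x -> density x = 0%R.
Proof. by move=> Ix; rewrite /density /slowness patchE memNset// mul0r. Qed.

Lemma stationary_itv a b : I a -> I b -> (a <= b)%R ->
  nu `[a, b[%classic = \int[leb]_(x in `[a, b[) (density x)%:E.
Proof.
move=> Ia Ib ab; have := slowness_balance Ia Ib ab.
have marr D : measurable_fun D (fun x : T => (slowness x)%:E * arrival_rate x).
  apply: emeasurable_funM; first exact: measurable_slownessE.
  by apply: measurable_funTS; exact: measurable_arrival_rate.
have sa0 x : 0 <= (slowness x)%:E * arrival_rate x.
  by rewrite mule_ge0 ?arrival_rate_ge0// lee_fin slowness_ge0.
have arr_lty : \int[leb]_(x in `[a, b[) ((slowness x)%:E * arrival_rate x) < +oo.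
  rewrite (@le_lt_trans _ _ (\int[leb]_(x in `[a, b[) (total_rate%:E * (slowness x)%:E)))//.
    apply: ge0_le_integral => //.
    - apply: emeasurable_funM => //; exact: measurable_slownessE.
    - move=> x _; rewrite muleC lee_wpmul2r ?lee_fin ?slowness_ge0//.
      exact: le_trans (arrival_le_takeoff x) (takeoff_rate_le x).
  rewrite ge0_integralZl//; last 3 first.
  - exact: measurable_slownessE.
  - by move=> x _; rewrite lee_fin slowness_ge0.
  - exact: le_trans (takeoff_rate_ge0 a) (takeoff_rate_le a).
  rewrite -clockE lte_mul_pinfty ?clock_lty//.
  exact: le_trans (takeoff_rate_ge0 a) (takeoff_rate_le a).
have -> : \int[leb]_(x in `[a, b[) ((slowness x)%:E * takeoff_rate x) =
    \int[leb]_(x in `[a, b[) ((slowness x)%:E * arrival_rate x) +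
    \int[leb]_(x in `[a, b[) (density x)%:E.
  rewrite -ge0_integralD//; last 2 first.
  - by move=> x _; rewrite lee_fin density_ge0.
  - by apply/measurable_EFinP; apply: measurable_funTS; exact: measurable_density.
  apply: eq_integral => x _; rewrite takeoff_flux ge0_muleDr ?arrival_rate_ge0 ?lee_fin ?flux_ge0//.
move/esym; apply: adde_injl; rewrite ge0_fin_numE//.
by apply: integral_ge0 => x _.
Qed.

Lemma stationary_interior A : measurable A -> A `<=` I ->
  nu A = \int[leb]_(x in A) (density x)%:E.
Proof.
have mf : measurable_fun [set: T] (fun x => (density x)%:E : \bar R).
  by apply/measurable_EFinP; exact: measurable_density.
have f0 (x : T) : 0 <= (density x)%:E :> \bar R by rewrite lee_fin density_ge0.
apply: (@finite_measure_unique_interior R w gamma nu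
  (weighted_image leb mf f0 (@measurable_id _ T setT))).
  by rewrite (le_lt_trans (probability_le1 _ _))// ltry.
move=> a b Ia Ib ab; exact: stationary_itv.
Qed.

(** The flow leaves the lower end of the state space at once, so that the time
spent there is null. *)
Lemma stationary_boundary : nu (E `\` I) = 0.
Proof.
pose g (y : T) : \bar R := (\1_(E `\` I) y)%:E.
have mEI : measurable (E `\` I).
  by apply: measurableD; [exact: measurable_state_space|exact: measurable_state_interior].
have mg : measurable_fun [set: T] g by apply/measurable_EFinP; exact: measurable_indic.
have g0 y : 0 <= g y by rewrite lee_fin.
rewrite -[E `\` I]setIT -integral_indic// -[LHS]mul1e -(@integral_occupation g 1%R ler01)//.
apply: eseries0 => n _ _; apply: integral0_eq => o _.
pose c := g (Z n o) * (jump_time S n o <= 1)%R%:R%:E.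
rewrite (_ : (fun _ => _) = fun u => c * (\1_[set (0 : R)%R] u)%:E); last first.
  apply/funext => u; rewrite indicE; have [->|u_neq0] := eqVneq u 0%R.
    rewrite mem_set// mule1 lexx S_gt0 addr0 /= flow_pointE ?(flow0 flow)//.
    by split; [exact: ZE|split => //=; exact: hitting_time_gt0].
  rewrite memNset; last by move/eqP: u_neq0.
  rewrite mule0; have [/andP[/andP[u0 uS] _]|] := boolP (_ && _); last by rewrite mule0.
  have {}u0 : (0 < u)%R by rewrite lt_neqAle eq_sym u_neq0.
  have utau : u%:E < tau (Z n o) by rewrite (lt_le_trans _ (S_le n o))// lte_fin.
  rewrite /g indicE memNset ?mul0e// flow_pointE; last first.
    by split; [exact: ZE|split => //=; exact: ltW].
  by move=> [_]; apply; exact: flow_interior.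
rewrite ge0_integralZl//; last 2 first.
- by apply/measurable_EFinP; exact: measurable_indic.
- by rewrite mule_ge0// lee_fin.
rewrite integral_indic// setIT [X in c * X](_ : _ = 0) ?mule0//.
exact: lebesgue_measure_set1.
Qed.

Lemma stationary_density A : measurable A -> A `<=` E ->
  nu A = \int[leb]_(x in A) (density x)%:E.
Proof.
move=> mA AE; have mI := measurable_state_interior.
have mAI : measurable (A `&` I) by exact: measurableI.
transitivity (nu (A `&` I)).
  rewrite -[in LHS](setUIDK A I) measureU//; last 2 first.
  - exact: measurableD.
  - by apply/seteqP; split => // x [[_ Ix] []].
  rewrite [X in _ + X](_ : _ = 0) ?adde0//; apply/eqP; rewrite -measure_le0.
  rewrite -stationary_boundary le_measure ?inE//.
  - exact: measurableD.
  - by apply: measurableD => //; exact: measurable_state_space.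
  - by move=> x [Ax Ix]; split => //; exact: AE.
rewrite stationary_interior//.
rewrite integral_mkcondr; apply: eq_integral => x _; rewrite patchE.
by case: ifPn => // /negP Ix; rewrite density_eq0// => Ix'; apply: Ix; exact/mem_set.
Qed.

Lemma integral_stationary (k : T -> \bar R) : measurable_fun [set: T] k ->
  (forall y, 0 <= k y) -> (forall y, ~ E y -> k y = 0) ->
  \int[nu]_y k y = \int[leb]_(y in E) (k y * (density y)%:E).
Proof.
move=> mk k0 kE.
have mf : measurable_fun [set: T] (fun x => (density x)%:E : \bar R).
  by apply/measurable_EFinP; exact: measurable_density.
have f0 (x : T) : 0 <= (density x)%:E :> \bar R by rewrite lee_fin density_ge0.
transitivity (\int[nu]_(y in E) k y).
  rewrite [RHS]integral_mkcond; apply: eq_integral => y _; rewrite patchE.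
  by case: ifPn => // /negP Ey; rewrite kE// => Ey'; apply: Ey; exact/mem_set.
have mE := measurable_state_space.
transitivity (\int[weighted_image leb mf f0 (@measurable_id _ T setT)]_(y in E) k y).
  apply: eq_measure_integral => A mA AE; exact: stationary_density.
rewrite integral_mkcond ge0_integral_weighted_image//; last 2 first.
- by apply/(measurable_restrictT _ mE); exact: measurable_funTS.
- by move=> y; rewrite patchE; case: ifPn.
rewrite [RHS]integral_mkcond; apply: eq_integral => y _; rewrite !patchE.
by case: ifPn => // _; rewrite mul0e.
Qed.

(** * The integro-differential equation *)

Let measurable_below x : measurable [set y : T | w <= y%:E < x%:E].
Proof.
rewrite (_ : [set _ | _] = [set y : T | w <= y%:E] `&` `]-oo, x[%classic).
  apply: measurableI; last exact: measurable_itv.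
  by rewrite -[X in measurable X]setTI; exact: measurable_lee.
apply/seteqP; split => y /=; rewrite in_itv/= lte_fin; first by move/andP.
by move=> [-> ->].
Qed.

Let measurable_above x : measurable [set y : T | x%:E <= y%:E < gamma].
Proof.
rewrite (_ : [set _ | _] = `[x, +oo[%classic `&` [set y : T | y%:E < gamma]).
  apply: measurableI; first exact: measurable_itv.
  by rewrite -[X in measurable X]setTI; exact: measurable_lte.
apply/seteqP; split => y /=; rewrite in_itv/= lee_fin andbT; first by move/andP.
by move=> [-> ->].
Qed.

Let mu_fin z A : measurable A -> mu z A \is a fin_num.
Proof.
move=> mA; rewrite ge0_fin_numE// (le_lt_trans _ (ltry 1%R))//.
by rewrite -(prob_kernel (s := mu) z) le_measure// inE.
Qed.

Lemma mu_split x z : I x -> E z \/ active_boundary gamma z ->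
  mu z [set y : T | w <= y%:E < x%:E] + mu z [set y : T | x%:E <= y%:E < gamma] = 1.
Proof.
move=> /andP[wx xg] Ez; rewrite -measureU//; last first.
  apply/seteqP; split => // y [/= /andP[_]]; rewrite lte_fin => yx /andP[].
  by rewrite lee_fin leNgt yx.
rewrite -(mu_state_space Ez); congr (mu z _); apply/seteqP; split => y /=.
  move=> [/andP[wy yx]|/andP[xy yg]]; apply/andP; split => //.
    exact: lt_trans xg.
  exact: le_trans (ltW wx) xy.
by move=> /andP[wy yg]; have [xy|yx] := leP x%:E y%:E; [right|left]; apply/andP.
Qed.

Lemma mu_above x z : I x -> E z \/ active_boundary gamma z ->
  mu z `[x, +oo[%classic = mu z [set y : T | x%:E <= y%:E < gamma].
Proof.
move=> /andP[wx xg] Ez; have mE := measurable_state_space.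
have mx : measurable (`[x, +oo[%classic : set T) by exact: measurable_itv.
have muEC : mu z (~` E) = 0.
  apply: (@adde_injl _ (mu z E)); first exact: mu_fin.
  rewrite -measureU//; [|exact: measurableC|exact: setICr].
  by rewrite setUv adde0 mu_state_space//; exact: prob_kernel.
rewrite -[in LHS](setUIDK `[x, +oo[%classic E) measureU//; last 3 first.
- exact: measurableI.
- exact: measurableD.
- by apply/seteqP; split => // y [[_ Ey] []].
rewrite [X in _ + X](_ : _ = 0) ?adde0; last first.
  apply/eqP; rewrite -measure_le0 -muEC le_measure ?inE//.
  - exact: measurableD.
  - exact: measurableC.
congr (mu z _); apply/seteqP; split => y /=; rewrite in_itv/= andbT -lee_fin.
  by move=> [-> /andP[_ ->]].
by move=> /andP[xy yg]; split => //; rewrite /state_space /= yg (le_trans (ltW wx)).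
Qed.

(** The first term counts the jumps that start above x, the second one those
that end there: theta is the integrand of the flux. *)
Lemma theta_above x z : I x -> E z \/ active_boundary gamma z ->
  theta w gamma mu x z = ((x <= z)%R%:R - fine (mu z `[x, +oo[%classic))%R.
Proof.
move=> Ix Ez; rewrite mu_above// /theta.
have [xz|zx] := leP x z; last by rewrite mul0r mul1r.
rewrite mul1r mul0r subr0; have := mu_split Ix Ez.
rewrite -(fineK (mu_fin z (measurable_below x))) -(fineK (mu_fin z (measurable_above x))).
by move=> [<-]; rewrite addrK.
Qed.

Lemma theta_below x z : I x -> E z \/ active_boundary gamma z ->
  theta w gamma mu x z =
  (fine (mu z [set y : R | (w <= y%:E < x%:E)%E]) - (z < x)%R%:R)%R.
Proof.
move=> Ix Ez; rewrite theta_above// mu_above//; have := mu_split Ix Ez.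
rewrite -(fineK (mu_fin z (measurable_below x))) -(fineK (mu_fin z (measurable_above x))).
move=> [mu1]; have -> : fine (mu z [set y : T | (w <= y%:E < x%:E)%E]) =
    (1 - fine (mu z [set y : T | (x%:E <= y%:E < gamma)%E]))%R by rewrite -mu1 addrK.
by case: leP => _ /=; rewrite ?subr0// sub0r addrAC subrr sub0r.
Qed.

Lemma boundary_rate_eq0 : gamma = +oo -> sigma = 0%R.
Proof.
move=> gy; apply/EFin_inj; rewrite -forced_rate.
apply: eseries0 => n _ _; rewrite (_ : [set _ | _] = set0) ?measure0//.
by apply/seteqP; split => // o [_]; rewrite /active_boundary /= gy.
Qed.

Lemma velocity_density x : I x -> (r x * density x)%R = flux x.
Proof.
move=> Ix; rewrite /density slownessE// mulrA mulfV ?mul1r//.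
by rewrite gt_eqF// (flow_velocity_gt0 flow).
Qed.

(** The flux is the difference of the two rates, both of which are integrals
with respect to lambda nu + sigma delta_gamma. *)
Lemma density_equation x : I x ->
  (r x * density x)%:E =
  \int[leb]_(z in E) (lambda z * theta w gamma mu x z * density z)%:E +
  (if gamma is g%:E then (sigma * theta w gamma mu x g)%:E else 0).
Proof.
move=> Ix; rewrite velocity_density//.
have mE := measurable_state_space.
pose m (y : T) : R := fine (mu y `[x, +oo[%classic).
have mx : measurable (`[x, +oo[%classic : set T) by exact: measurable_itv.
have mE_m y : mu y `[x, +oo[%classic = (m y)%:E by rewrite /m fineK// mu_fin.
have m_ge0 y : (0 <= m y)%R by exact: fine_ge0.
have mm : measurable_fun [set: T] m.
  apply: measurableT_comp; first exact: fine_measurable.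
  exact: measurable_kernel.
pose b (y : T) : R := (x <= y)%R%:R.
have mb : measurable_fun [set: T] b.
  by apply/measurable_EFinP; apply: measurable_fun_bool_indic; exact: measurable_set_le.
pose u (y : T) : R := (b y * intensity y * density y)%R.
pose v (y : T) : R := (m y * intensity y * density y)%R.
have mk (c : T -> R) : measurable_fun [set: T] c ->
    measurable_fun [set: T] (fun y => (c y * intensity y)%:E : \bar R).
  move=> mc; apply/measurable_EFinP.
  by apply: measurable_funM => //; exact: measurable_intensity.
have stat (c : T -> R) : measurable_fun [set: T] c -> (forall y, (0 <= c y)%R) ->
    \int[nu]_y ((c y)%:E * (intensity y)%:E) =
    \int[leb]_(y in E) (c y * intensity y * density y)%:E.
  move=> mc c0; under eq_integral do rewrite -EFinM.
  rewrite integral_stationary; first exact: eq_integral.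
  - exact: mk.
  - by move=> y; rewrite lee_fin mulr_ge0// intensity_ge0.
  - by move=> y Ey; rewrite /intensity patchE memNset// mulr0.
have integrable_stat (c : T -> R) : measurable_fun [set: T] c -> (forall y, (0 <= c y)%R) ->
    \int[leb]_(y in E) (c y * intensity y * density y)%:E < +oo ->
    leb.-integrable E (EFin \o (fun y => c y * intensity y * density y)%R).
  move=> mc c0 clty; apply/integrableP; split.
    apply/measurable_EFinP; apply: measurable_funTS.
    apply: measurable_funM; last exact: measurable_density.
    by apply: measurable_funM => //; exact: measurable_intensity.
  rewrite (_ : (fun _ => _) = fun y => (c y * intensity y * density y)%:E)//.
  apply/funext => y; rewrite /= ger0_norm//.
  by rewrite mulr_ge0 ?density_ge0// mulr_ge0// intensity_ge0.
have b_ge0 y : (0 <= b y)%R by [].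
have takeoffE : takeoff_rate x = (sigma * b (fine gamma))%:E + \int[leb]_(y in E) (u y)%:E.
  by rewrite takeoff_rateE (stat b).
have arrivalE : arrival_rate x = (sigma * m (fine gamma))%:E + \int[leb]_(y in E) (v y)%:E.
  rewrite arrival_rateE mE_m -(stat m)//.
  by congr (_ + _); apply: eq_integral => y _; rewrite mE_m.
have := takeoff_rate_fin x; rewrite takeoffE fin_numD => /andP[_ ufin].
have := arrival_rate_fin x; rewrite arrivalE fin_numD => /andP[_ vfin].
have uvE : \int[leb]_(z in E) (lambda z * theta w gamma mu x z * density z)%:E =
    \int[leb]_(y in E) (u y)%:E - \int[leb]_(y in E) (v y)%:E.
  rewrite -integralB_EFin//.
  - apply: eq_integral => y /set_mem Ey; rewrite theta_above//; last by left.
    rewrite -EFinB /u /v /b -/(m y) /intensity patchE mem_set//; congr EFin.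
    by ring.
  - by apply: integrable_stat => //; rewrite ltey_eq ufin.
  - by apply: integrable_stat => //; rewrite ltey_eq vfin.
rewrite uvE /flux takeoffE arrivalE -(fineK ufin) -(fineK vfin) -!EFinD /=.
have boundaryE : (if gamma is g%:E then (sigma * theta w gamma mu x g)%:E else 0) =
    (sigma * (b (fine gamma) - m (fine gamma)))%:E.
  have thetaE g : gamma = g%:E -> theta w gamma mu x g = (b g - m g)%R.
    by move=> gE; apply: theta_above => //; right; exact: esym.
  have /andP[_] := Ix; case gammaE : gamma => [g| |]// _.
    by rewrite -gammaE thetaE ?gammaE.
  by rewrite boundary_rate_eq0// mul0r.
rewrite boundaryE -EFinD; congr EFin; ring.
Qed.

Lemma stationary_is_density : is_density w gamma nu density.
Proof.
split.
- by apply: measurable_funTS; exact: measurable_density.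
- by move=> x _; exact: density_ge0.
- exact: stationary_density.
Qed.

Lemma stationary_dominates : nu `<< leb.
Proof.
have mE := measurable_state_space.
apply/null_content_dominatesP => A mA A0.
have nuEC : nu (~` E) = 0 by rewrite probability_setC// nu_state_space subee.
rewrite -[A](setUIDK A E) measureU//; last 3 first.
- exact: measurableI.
- exact: measurableD.
- by apply/seteqP; split => // y [[_ Ey] []].
rewrite [X in _ + X](_ : _ = 0) ?adde0; last first.
  apply/eqP; rewrite -measure_le0 -nuEC le_measure ?inE//.
  - exact: measurableD.
  - exact: measurableC.
apply: (eq_trans (stationary_density (measurableI _ _ mA mE) (@subIsetr _ A E))).
apply: null_set_integral; first exact: measurableI.
  by apply/measurable_EFinP; apply: measurable_funTS; exact: measurable_density.
by apply/eqP; rewrite -measure_le0 -A0 le_measure ?inE//; exact: measurableI.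
Qed.

End stationary.
End process.

(** * The law of the process started from the stationary distribution *)

Section started.
Context d (Omega : measurableType d).
Variables (Z S : nat -> Omega -> R) (mu : R.-pker T ~> T) (P : R.-pker T ~> Omega)
  (nu : probability T R) (sigma : R).
Hypotheses (pdmp : is_pdmp w gamma phi Z S lambda mu P)
  (mu_state_space : forall x, E x \/ active_boundary gamma x -> mu x E = 1)
  (finite_jumps : forall x (t : R), E x -> (0 < t)%R ->
     \int[P x]_o jumps S t o < +oo)
  (stationary : is_stationary w gamma phi Z S P nu)
  (intensity_nu : \int[nu]_(x in E) (lambda x)%:E < +oo)
  (boundary_rate : is_boundary_rate w gamma phi Z S P nu sigma).

Let mZ := pdmp_measurable_position pdmp.
Let mS := pdmp_measurable_sojourn pdmp.
Let ZE := pdmp_position_in pdmp.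
Let S_gt0 := pdmp_sojourn_gt0 pdmp.
Let S_le := pdmp_sojourn_le pdmp.
Let Q := averaged_law P nu.
Let mE : measurable E := @measurable_state_space.

Lemma history_measurable n m H : history Z S n m H -> measurable H.
Proof.
apply: smallest_sub; first exact: sigma_algebra_measurable.
by move=> _ [i [A [mA [[_ ->]|[_ ->]]]]]; exact: measurable_preimage_setT.
Qed.

Let stationary_measure A : measurable A -> Q A = \int[nu]_(x in E) P x A.
Proof.
move=> mA; rewrite /Q averaged_lawE//; apply: ge0_integral_full_set => //.
  exact: (stationary_on stationary).
exact: measurable_kernel.
Qed.

Let stationary_integral h : measurable_fun [set: Omega] h -> (forall o, 0 <= h o) ->
  \int[Q]_o h o = \int[nu]_(x in E) \int[P x]_o h o.
Proof.
move=> mh h0; rewrite /Q integral_averaged_law//; apply: ge0_integral_full_set => //.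
- exact: (stationary_on stationary).
- exact: measurable_integral_law_from.
- by move=> x; exact: integral_ge0.
Qed.

(** A law conditional on the past that is the same from every initial position
holds for a random one too. *)
Let conditional_law H A (k : Omega -> \bar R) : measurable H -> measurable A ->
  measurable_fun [set: Omega] k -> (forall o, 0 <= k o) ->
  (forall x, E x -> P x (H `&` A) = \int[P x]_(o in H) k o) ->
  Q (H `&` A) = \int[Q]_(o in H) k o.
Proof.
move=> mH mA mk k0 HA; rewrite stationary_measure; last exact: measurableI.
rewrite [RHS]integral_mkcond stationary_integral; last 2 first.
- by apply/(measurable_restrictT _ mH); exact: measurable_funTS.
- by move=> o; rewrite patchE; case: ifPn.
by apply: eq_integral => x /set_mem Ex; rewrite HA// [LHS]integral_mkcond.
Qed.

Let mlanding n := measurable_landing mZ mS ZE S_gt0 S_le n.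

Let sojourn n H t : history Z S n.+1 n H -> (0 <= t)%R ->
  Q (H `&` [set o | (t < S n o)%R]) =
  \int[Q]_(o in H) survival gamma phi lambda (Z n o) t.
Proof.
move=> hH t0; apply: conditional_law.
- exact: history_measurable hH.
- exact: measurable_set_lt.
- rewrite (_ : (fun _ => _) = fun o => (survival_fun (Z n o, t))%:E).
    apply/measurable_EFinP; apply: measurableT_comp.
      exact: measurable_survival_fun.
    exact: measurable_fun_pair.
  by apply/funext => o; rewrite survivalE.
- by move=> o; rewrite survivalE// lee_fin survival_fun_ge0.
- by move=> x Ex; exact: (pdmp_sojourn_law pdmp Ex hH t0).
Qed.

Let jump_law n H A : history Z S n.+1 n.+1 H -> measurable A ->
  Q (H `&` Z n.+1 @^-1` A) = \int[Q]_(o in H) mu (phi (Z n o) (S n o)) A.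
Proof.
move=> hH mA; apply: conditional_law => //.
- exact: history_measurable hH.
- exact: measurable_preimage_setT.
- exact: (measurableT_comp (measurable_kernel mu A mA) (mlanding n)).
- by move=> x Ex; exact: (pdmp_jump_law pdmp Ex hH mA).
Qed.

Let stationary_law t A : (0 <= t)%R -> measurable A ->
  Q (pdmp_path phi Z S t @^-1` A) = nu A.
Proof.
move=> t0 mA; rewrite stationary_measure ?(stationary_eq stationary)//.
exact: measurable_preimage_setT (measurable_pdmp_path mZ mS ZE S_gt0 S_le t0) mA.
Qed.

Let measurable_jump_le n t : measurable [set o | (jump_time S n o <= t)%R].
Proof. by apply: measurable_set_le => //; exact: measurable_jump_time. Qed.

(** If all the jumps occurred before a given date with positive probability,
this probability would count once for each jump in the expected number of
jumps before that date. *)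
Lemma explosion_event_null x t : E x -> (0 <= t)%R -> P x (explosion_event S t) = 0.
Proof.
move=> Ex t0; have t1 : (0 < t + 1)%R by rewrite ltr_wpDl.
have mK := measurable_explosion_event mS t.
set c := P x _.
have := finite_jumps Ex t1; rewrite /jumps integral_nneseries//; last first.
  by move=> n; apply/measurable_EFinP; exact: measurable_indic.
move=> fin.
have c_sum : \sum_(n <oo) c < +oo.
  apply: le_lt_trans fin; apply: lee_nneseries => [n _ _|n _]; first exact: measure_ge0.
  rewrite integral_indic// setIT le_measure ?inE// => o Ko /=.
  by rewrite (le_trans (Ko n.+1))// lerDl.
apply: nneseries_cst_eq0 c_sum; exact: measure_ge0.
Qed.

Let no_explosion t : (0 <= t)%R -> Q (explosion_event S t) = 0.
Proof.
move=> t0; rewrite stationary_measure; last exact: measurable_explosion_event.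
by apply: integral0_eq => x Ex; exact: explosion_event_null.
Qed.

Let forced_rate : \sum_(n <oo) Q [set o | (jump_time S n.+1 o <= 1)%R /\
  active_boundary gamma (phi (Z n o) (S n o))] = sigma%:E.
Proof.
have mF n : measurable [set o | (jump_time S n.+1 o <= 1)%R /\
    active_boundary gamma (phi (Z n o) (S n o))].
  apply: measurableI; first exact: measurable_jump_le.
  apply: (measurable_preimage_setT (f := landing Z S n)); first exact: mlanding.
  case gammaE : gamma => [g| |].
  - rewrite (_ : active_boundary _ = [set g]); first exact: measurable_set1.
    by apply/seteqP; split => x; [case|move=> ->].
  - by rewrite (_ : active_boundary _ = set0)//; apply/seteqP; split => x.
  - by rewrite (_ : active_boundary _ = set0)//; apply/seteqP; split => x.
rewrite (boundary_rate ltr01) invr1 mule1 -stationary_integral; last 2 first.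
- apply: ge0_emeasurable_sum => // n _.
  by apply/measurable_EFinP; exact: measurable_indic.
- by move=> o; apply: nneseries_ge0 => n _ _; rewrite lee_fin.
rewrite /forced_jumps integral_nneseries//; last first.
  by move=> n; apply/measurable_EFinP; exact: measurable_indic.
by apply: eq_eseriesr => n _; rewrite integral_indic// setIT.
Qed.

Lemma stationary_equation :
  [/\ nu `<< leb, is_density w gamma nu (density Z S Q) &
    forall x, I x -> (r x * density Z S Q x)%:E =
      \int[leb]_(z in E) (lambda z * theta w gamma mu x z * density Z S Q z)%:E +
      (if gamma is g%:E then (sigma * theta w gamma mu x g)%:E else 0)].
Proof.
split.
- exact: (stationary_dominates mZ mS ZE S_gt0 S_le sojourn stationary_law
    no_explosion (stationary_on stationary) forced_rate intensity_nu).
- exact: (stationary_is_density mZ mS ZE S_gt0 S_le sojourn stationary_law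
    no_explosion forced_rate intensity_nu).
- move=> x Ix; exact: (density_equation mZ mS ZE S_gt0 S_le sojourn stationary_law
    no_explosion mu_state_space jump_law forced_rate intensity_nu Ix).
Qed.

End started.

End survival.
End flow.

Theorem theorem4 (R : realType) (w gamma : \bar R)
    (r : R -> R) (phi : R -> R -> R) (lambda : R -> R)
    (mu : R.-pker (measurableTypeR R) ~> (measurableTypeR R))
    (d : measure_display) (Omega : measurableType d)
    (P : R.-pker (measurableTypeR R) ~> Omega)
    (Z S : nat -> Omega -> R)
    (nu : probability (measurableTypeR R) R) (sigma : R)
    (w_lt_gamma : w < gamma)
    (flow : is_flow w gamma r phi)
    (lambda_measurable : measurable_fun (state_space w gamma) lambda)
    (lambda_ge0 : forall x, state_space w gamma x -> (0 <= lambda x)%R)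
    (mu_state_space : forall x,
      state_space w gamma x \/ active_boundary gamma x ->
      mu x (state_space w gamma) = 1)
    (pdmp : is_pdmp w gamma phi Z S lambda mu P)
    (A1 : forall x, state_space w gamma x ->
      exists e : R, [/\ (0 < e)%R, e%:E <= hitting_time gamma phi x &
        \int[lebesgue_measure]_(s in `[0%R, e]) (lambda (phi x s))%:E < +oo])
    (A2 : forall x, state_space w gamma x -> hitting_time gamma phi x = +oo ->
      \int[lebesgue_measure]_(s in `[0%R, +oo[) (lambda (phi x s))%:E = +oo)
    (A3 : forall x (t : R), state_space w gamma x -> (0 < t)%R ->
      \int[P x]_o jumps S t o < +oo)
    (A4 : forall x, state_space w gamma x -> mu x [set x] = 0)
    (B1 : is_stationary w gamma phi Z S P nu)
    (B2 : \int[nu]_(x in state_space w gamma) (lambda x)%:E < +oo)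
    (B3 : {within state_space w gamma, continuous lambda})
    (B4 : forall (A : set R) x, measurable A -> A `<=` state_space w gamma ->
      state_space w gamma x -> mu (phi x h) A @[h --> 0%R^'+] --> mu x A)
    (B5 : forall g : R, active_boundary gamma g ->
      mu g [set x : R | state_space w gamma x /\
                        hitting_time gamma phi x < h%:E]
        @[h --> 0%R^'+] --> 0)
    (sigma_rate : is_boundary_rate w gamma phi Z S P nu sigma) :
  [/\ (* nu is absolutely continuous *)
      nu `<< @lebesgue_measure R,
      (* a version of the density satisfies the equation at every point *)
      exists2 f : R -> R, is_density w gamma nu f &
        forall x, state_interior w gamma x ->
          (r x * f x)%:E =
            \int[lebesgue_measure]_(z in state_space w gamma)
              (lambda z * theta w gamma mu x z * f z)%:E
            + (if gamma is g%:E then (sigma * theta w gamma mu x g)%:E else 0)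
    & (* the second expression of theta *)
      forall x z, state_interior w gamma x ->
        state_space w gamma z \/ active_boundary gamma z ->
        theta w gamma mu x z =
          (fine (mu z [set y : R | (w <= y%:E < x%:E)%E]) - (z < x)%R%:R)%R].

Proof.
have [ac dens eqn] := stationary_equation flow lambda_measurable lambda_ge0 B3 pdmp
  mu_state_space A3 B1 B2 sigma_rate.
split=> //; first by eexists; [exact: dens|exact: eqn].
by move=> x z Ix Ez; exact: theta_below.
Qed.
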